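(* There is an infinite family $\mathcal{F}$ of planar triangulations such that $\iota(G) = 2n/7$ for every $G\in\mathcal{F}$, where $n$ is the number of vertices of $G$.
   Context: A planar triangulation is a plane graph in which every face is bounded by a triangle. $\iota(G)$ denotes the minimum cardinality of a set $S\subseteq V(G)$ that is independent (no two vertices of $S$ adjacent) and dominating (every vertex of $G$ is in $S$ or adjacent to a vertex of $S$). *)

(* Defs.v *)
From HB Require Import structures.
From mathcomp Require Import all_boot all_order all_algebra.
From mathcomp Require Import all_classical all_reals all_analysis.
Set Implicit Arguments.
Unset Strict Implicit.
Unset Printing Implicit Defensive.
Import Order.TTheory GRing.Theory Num.Theory.
Import numFieldNormedType.Exports.
Local Open Scope classical_set_scope.
Local Open Scope ring_scope.

Record sgraph := SGraph {
  vertex :> finType;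
  adj : rel vertex;
  adj_sym : symmetric adj;
  adj_irr : irreflexive adj }.

Definition isomorphic (G H : sgraph) : Prop :=
  exists f : G -> H,
    bijective f /\ forall x y : G, adj (f x) (f y) = adj x y.

Definition independent (G : sgraph) (S : {set G}) : bool :=
  [forall x in S, forall y in S, ~~ adj x y].

Definition dominating (G : sgraph) (S : {set G}) : bool :=
  [forall x, (x \in S) || [exists y in S, adj x y]].

(* The default value #|G| does not affect the minimum: every S : {set G} has
   #|S| <= #|G|, and a maximal independent set is independent dominating. *)
Definition indep_dom_number (G : sgraph) : nat :=
  \big[minn/#|G|]_(S : {set G} | independent S && dominating S) #|S|.

Definition is_arc (R : realType) (p q : R * R) (A : set (R * R)) : Prop :=
  exists g : R -> R * R,
    [/\ {within `[0, 1]%classic, continuous g}, set_inj `[0, 1]%classic g,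
        g 0 = p, g 1 = q & A = g @` `[0, 1]%classic].

(* A finite simple graph drawn in the plane R^2: vertices are distinct points,
   the edge xy is an arc between the points of x and y, and the interior of an
   edge contains no vertex and no point of another edge. The value of [edge]
   on non-adjacent pairs is irrelevant. *)
Record plane_graph (R : realType) := PlaneGraph {
  graph :> sgraph;
  point : graph -> R * R;
  edge : graph -> graph -> set (R * R);
  point_inj : injective point;
  edge_arc : forall x y, adj x y -> is_arc (point x) (point y) (edge x y);
  edge_sym : forall x y, adj x y -> edge x y = edge y x;
  edge_vertex : forall x y z, adj x y -> edge x y (point z) ->
    z = x \/ z = y;
  edge_edge : forall x y x' y', adj x y -> adj x' y' ->
    [set x; y]%SET != [set x'; y']%SET ->
    (edge x y `\` [set point x; point y]) `&` edge x' y' = set0 }.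

Definition drawing (R : realType) (G : plane_graph R) : set (R * R) :=
  [set p | (exists x : G, p = @point R G x) \/
           (exists x y : G, adj x y /\ @edge R G x y p)].

Definition is_face (R : realType) (G : plane_graph R) (F : set (R * R)) : Prop :=
  exists2 p, (~` drawing G) p & F = connected_component (~` drawing G) p.

Definition frontier (T : topologicalType) (A : set T) : set T :=
  closure A `\` interior A.

Definition bounded_by_triangle (R : realType) (G : plane_graph R)
    (F : set (R * R)) : Prop :=
  exists x y z : G, [/\ adj x y, adj y z, adj z x &
    frontier F = @edge R G x y `|` @edge R G y z `|` @edge R G z x].

Definition planar_triangulation (R : realType) (G : plane_graph R) : Prop :=
  forall F, is_face G F -> bounded_by_triangle G F.

(* Infinitely many members up to graph isomorphism; counting plane graphs
   themselves would be vacuous, as every drawing has infinitely many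
   translates. *)
Definition infinite_family (R : realType) (F : plane_graph R -> Prop) : Prop :=
  exists G : nat -> plane_graph R,
    (forall i, F (G i)) /\ (forall i j, isomorphic (G i) (G j) -> i = j).

(* Main.v *)
Require Import Defs.
From HB Require Import structures.
From mathcomp Require Import all_boot all_order all_algebra.
From mathcomp Require Import all_classical all_reals all_analysis.
From mathcomp Require Import zify ring lra.
Import Order.TTheory GRing.Theory Num.Theory.
Import numFieldNormedType.Exports.
Local Open Scope classical_set_scope.
Local Open Scope ring_scope.
Set Implicit Arguments.
Unset Strict Implicit.
Unset Printing Implicit Defensive.

(** Inserting an octahedron into a triangular face xyz adds a triangle def with
d ~ y, z, e ~ x, z and f ~ x, y. An independent set contains at most one of x, y, z,
and no single corner dominates d, e and f, so every independent dominating set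
contains one of d, e, f: three new vertices always cost one. A triangulation on N
vertices having a vertex v of degree 3 has 2N - 7 faces not incident with v. Inserting
octahedra into exactly these faces gives n = N + 3(2N - 7) = 7(N - 3) vertices, and
since the closed neighbourhood of v must be hit as well, every independent dominating
set has at least (2N - 7) + 1 = 2(N - 3) = 2n/7 elements. Equality holds if some
neighbour a of v is adjacent to all other vertices of the triangulation: take a and,
in each octahedron, a vertex not adjacent to a.

Here v = 0, a = 1, and the triangulation is obtained by repeatedly stacking a new
vertex into the face spanned by 1, 2 and the vertex stacked last. The drawing is
straight-line; both operations paste a fixed drawing of a subdivided triangle into a
face by an affine map, so that the planarity of only two small drawings has to be
checked, and that is linear arithmetic. Faces are open triangles and the exterior of
the outer triangle: these sets are open, connected, disjoint from the drawing and have
their frontier in it, hence they are the components of its complement. *)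

(** * Components of the complement of a closed-up region *)

(** [A] is relatively open in the complement of [D], and relatively closed because its closure
    leaves it only inside [D]. So it cuts a nonempty clopen part out of the connected component,
    hence all of it. *)
Lemma component_of_open (T : topologicalType) (D A : set T) (p : T) :
  open A -> connected A -> A `<=` ~` D -> closure A `\` A `<=` D -> A p ->
  connected_component (~` D) p = A.
Proof.
move=> oA cA AD clA Ap; apply/seteqP; split; last first.
  exact: connected_component_max.
set C := connected_component _ _.
have CD : C `<=` ~` D by exact: connected_component_sub.
have Cp : C p by apply: connected_component_refl; exact: AD.
have <- : C `&` A = C; last by move=> x [].
apply: (@component_connected _ (~` D) p); first by exists p.
- by exists A.
- exists (closure A); first exact: closed_closure.
  apply/seteqP; split => x [Cx Ax]; split=> //; first exact: subset_closure.
  by apply: contrapT => nAx; apply: (CD x) => //; apply: clA.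
Qed.

(** * Barycentric coordinates and segments in the plane *)

Section Plane.
Variable R : realType.
Implicit Types (x y z p q : R * R) (s t : R).

Definition lerp x y t : R * R :=
  ((1 - t) * x.1 + t * y.1, (1 - t) * x.2 + t * y.2).

(** [p.1], [p.2] and [1 - p.1 - p.2] are barycentric coordinates with respect to [x], [y], [z], so
    the points [(1, 0)], [(0, 1)], [(0, 0)] go to [x], [y], [z]. *)
Definition affm x y z p : R * R :=
  (p.1 * x.1 + p.2 * y.1 + (1 - p.1 - p.2) * z.1,
   p.1 * x.2 + p.2 * y.2 + (1 - p.1 - p.2) * z.2).

(** Twice the signed area of the triangle; with it, [bary] is Cramer's rule. *)
Definition dt x y z : R :=
  (x.1 - z.1) * (y.2 - z.2) - (y.1 - z.1) * (x.2 - z.2).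

Definition bary x y z p : R * R :=
  (dt p y z / dt x y z, dt x p z / dt x y z).

Lemma affmK x y z : dt x y z != 0 -> cancel (affm x y z) (bary x y z).
Proof.
move=> d0 [u v]; rewrite /bary /affm /dt /= in d0 *.
by congr pair; field.
Qed.

Lemma baryK x y z : dt x y z != 0 -> cancel (bary x y z) (affm x y z).
Proof.
move=> d0 [u v]; rewrite /bary /affm /dt /= in d0 *.
by congr pair; field.
Qed.

Lemma affm_lerp x y z p q t :
  affm x y z (lerp p q t) = lerp (affm x y z p) (affm x y z q) t.
Proof. by rewrite /affm /lerp /=; congr pair; ring. Qed.

Lemma affm_affm x y z p q r (w : R * R) :
  affm x y z (affm p q r w) =
  affm (affm x y z p) (affm x y z q) (affm x y z r) w.
Proof. by rewrite /affm /=; congr pair; ring. Qed.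

Lemma dt_affm x y z p q r :
  dt (affm x y z p) (affm x y z q) (affm x y z r) = dt x y z * dt p q r.
Proof. by rewrite /affm /dt /=; ring. Qed.

Lemma lerpC x y t : lerp x y t = lerp y x (1 - t).
Proof. by rewrite /lerp; congr pair; ring. Qed.

Lemma lerp0 x y : lerp x y 0 = x.
Proof. by case: x => a b; rewrite /lerp /=; congr pair; ring. Qed.

Lemma lerp1 x y : lerp x y 1 = y.
Proof. by case: y => a b; rewrite /lerp /=; congr pair; ring. Qed.

Lemma continuous_pair (T : topologicalType) (f g : T -> R) :
  continuous f -> continuous g -> continuous (fun a => (f a, g a)).
Proof. by move=> cf cg a; have := cvg_pair (cf a) (cg a); apply. Qed.

Lemma continuous_affine (a b c : R) :
  continuous (fun p : R * R => a * p.1 + b * p.2 + c).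
Proof.
move=> p; apply: cvgD; last exact: cvg_cst.
apply: cvgD; apply: cvgM; do ?exact: cvg_cst.
- exact: cvg_fst.
- exact: cvg_snd.
Qed.

Lemma continuous_lerp x y : continuous (lerp x y).
Proof.
by apply: continuous_pair => t; apply: cvgD; apply: cvgM; do ?exact: cvg_cst;
  do ?exact: cvg_id; apply: cvgB; do ?exact: cvg_cst; exact: cvg_id.
Qed.

Lemma continuous_affm x y z : continuous (affm x y z).
Proof.
apply: continuous_pair.
- rewrite [X in continuous X](_ : _ = fun p : R * R =>
    (x.1 - z.1) * p.1 + (y.1 - z.1) * p.2 + z.1); first exact: continuous_affine.
  by apply/funext => p; ring.
- rewrite [X in continuous X](_ : _ = fun p : R * R =>
    (x.2 - z.2) * p.1 + (y.2 - z.2) * p.2 + z.2); first exact: continuous_affine.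
  by apply/funext => p; ring.
Qed.

Lemma continuous_bary x y z : continuous (bary x y z).
Proof.
apply: continuous_pair.
- rewrite [X in continuous X](_ : _ = fun p : R * R =>
    ((y.2 - z.2) / dt x y z) * p.1 + (- (y.1 - z.1) / dt x y z) * p.2
    + (- z.1 * (y.2 - z.2) + (y.1 - z.1) * z.2) / dt x y z).
    exact: continuous_affine.
  by apply/funext => p; rewrite [dt p _ _]/dt; ring.
- rewrite [X in continuous X](_ : _ = fun p : R * R =>
    (- (x.2 - z.2) / dt x y z) * p.1 + ((x.1 - z.1) / dt x y z) * p.2
    + (- z.2 * (x.1 - z.1) + (x.2 - z.2) * z.1) / dt x y z).
    exact: continuous_affine.
  by apply/funext => p; rewrite [dt x p _]/dt; ring.
Qed.

(** The segments from [c] are connected and share [c], and star-shapedness makes [A] their union. *)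
Lemma star_connected (c : R * R) (A : set (R * R)) : A c ->
  (forall p t, A p -> 0 <= t -> t <= 1 -> A (lerp c p t)) -> connected A.
Proof.
move=> Ac starA.
rewrite (_ : A = \bigcup_(p in A) (lerp c p @` `[0, 1])).
  apply: bigcup_connected.
    by exists c => p _; exists 0; rewrite ?lerp0//= in_itv /= lexx ler01.
  move=> p _; apply: connected_continuous_connected; first exact: segment_connected.
  exact/continuous_subspaceT/continuous_lerp.
apply/seteqP; split => [p Ap|p [q Aq [t]]].
  by exists p => //; exists 1; rewrite ?lerp1//= in_itv /= lexx ler01.
by rewrite /= in_itv /= => /andP[t0 t1] <-; exact: starA.
Qed.

Lemma closure_lerp (p c : R * R) (A : set (R * R)) :
  (forall t, 0 < t -> t < 1 -> A (lerp p c t)) -> closure A p.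
Proof.
move=> Ac B; rewrite -{1}(lerp0 p c) => /(continuous_lerp (y := c)) /=.
move=> /nbhs_ballP[e /= e0 eB].
(* The bound [1 / 2] keeps [t] below 1, the bound [e / 2] keeps it in the ball around 0. *)
pose t := Num.min (e / 2) (1 / 2).
have t0 : 0 < t by rewrite lt_min; apply/andP; split; lra.
have t1 : t < 1 by rewrite gt_min; apply/orP; right; lra.
exists (lerp p c t); split; first exact: Ac.
apply: eB; rewrite /ball /= sub0r normrN gtr0_norm// gt_min.
by apply/orP; left; lra.
Qed.

(** Closures commute with a homeomorphism, and interiors are complements of closures of
    complements. *)
Lemma frontier_homeo (T : topologicalType) (f g : T -> T) (A : set T) :
  continuous f -> continuous g -> cancel f g -> cancel g f ->
  frontier (f @` A) = f @` frontier A.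
Proof.
move=> cf cg fK gK.
have preimE (h k : T -> T) (B : set T) : cancel h k -> cancel k h ->
    h @` B = k @^-1` B.
  move=> hK kK; apply/seteqP; split => [_ [b Bb <-]|b Bb] /=.
    by rewrite hK.
  by exists (k b).
have clS (h k : T -> T) (B : set T) : continuous k -> cancel h k ->
    cancel k h -> closure (h @` B) `<=` h @` closure B.
  move=> ck hK kK; rewrite closureE; apply: smallest_sub.
    rewrite (preimE _ _ _ hK kK); move/continuous_closedP: ck; apply.
    exact: closed_closure.
  by apply: image_subset; exact: subset_closure.
have clE (B : set T) : closure (f @` B) = f @` closure B.
  apply/seteqP; split; first exact: clS cg fK gK.
  move=> _ [b Bb <-].
  have := clS g f (f @` B) cf gK fK.
  rewrite image_comp (_ : g \o f = id) ?image_id; last exact/funext.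
  by move=> /(_ _ Bb)[c Bc <-]; rewrite gK.
have imC (B : set T) : f @` (~` B) = ~` (f @` B).
  by rewrite !(preimE _ _ _ fK gK) preimage_setC.
rewrite /frontier !setDE clE.
rewrite -[in LHS](setCK (interior (f @` A))) -closure_setC -imC clE closure_setC.
rewrite imC setCK !(preimE _ _ _ fK gK) preimage_setI preimage_setC.
by [].
Qed.

(** * The standard triangle, its exterior and their common frontier *)

Lemma open_halfplane (a b c : R) :
  open [set p : R * R | 0 < a * p.1 + b * p.2 + c].
Proof.
apply: (@open_comp _ _ _ [set r : R | 0 < r]); last exact: open_gt.
by move=> p _; exact: continuous_affine.
Qed.

Lemma closed_halfplane (a b c : R) :
  closed [set p : R * R | 0 <= a * p.1 + b * p.2 + c].
Proof.
have /continuous_closedP := @continuous_affine a b c.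
by move=> /(_ _ (@closed_ge _ 0)).
Qed.

Definition tri0 : set (R * R) := [set p | [/\ 0 < p.1, 0 < p.2 & p.1 + p.2 < 1]].

Definition ext0 : set (R * R) := [set p | [\/ p.1 < 0, p.2 < 0 | 1 < p.1 + p.2]].

Definition bd0 : set (R * R) := [set p | [/\ 0 <= p.1, 0 <= p.2, p.1 + p.2 <= 1 &
  [\/ p.1 = 0, p.2 = 0 | p.1 + p.2 = 1]]].

Lemma open_tri0 : open tri0.
Proof.
rewrite (_ : tri0 = [set p | 0 < 1 * p.1 + 0 * p.2 + 0] `&`
  ([set p | 0 < 0 * p.1 + 1 * p.2 + 0] `&`
   [set p | 0 < (-1) * p.1 + (-1) * p.2 + 1])).
  by do 2?[apply: openI; first exact: open_halfplane]; exact: open_halfplane.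
apply/seteqP; split => p /=; first by case=> *; do !split; lra.
by case=> ? [? ?]; split; lra.
Qed.

Lemma open_ext0 : open ext0.
Proof.
rewrite (_ : ext0 = [set p | 0 < (-1) * p.1 + 0 * p.2 + 0] `|`
  ([set p | 0 < 0 * p.1 + (-1) * p.2 + 0] `|`
   [set p | 0 < 1 * p.1 + 1 * p.2 + (-1)])).
  by do 2?[apply: openU; first exact: open_halfplane]; exact: open_halfplane.
apply/seteqP; split => p /=.
  by case=> *; [left|right; left|right; right]; lra.
by case=> [?|[?|?]]; [apply: Or31|apply: Or32|apply: Or33]; lra.
Qed.

Lemma connected_tri0 : connected tri0.
Proof.
apply: (@star_connected (1/4, 1/4)); first by split => /=; lra.
by move=> p t [p1 p2 p3] t0 t1; split; rewrite /lerp /=; nra.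
Qed.

(* Two of the three open half-planes covering [ext0] always meet. *)
Lemma connected_ext0 : connected ext0.
Proof.
rewrite (_ : ext0 = [set p | p.1 < 0] `|` [set p | p.2 < 0]
  `|` [set p | 1 < p.1 + p.2]); last first.
  by apply/seteqP; split => p /= [];
    [left; left|left; right|right|case; [apply: Or31|apply: Or32]|apply: Or33].
apply: connectedU.
- by exists (-1, 3); split => /=; [left|]; lra.
- apply: connectedU.
  + by exists (-1, -1); split => /=; lra.
  + apply: (@star_connected (-1, 0)) => /=; first by lra.
    by move=> p t /= *; rewrite /lerp /=; nra.
  + apply: (@star_connected (0, -1)) => /=; first by lra.
    by move=> p t /= *; rewrite /lerp /=; nra.
- apply: (@star_connected (2, 0)) => /=; first by lra.
  move=> p t /= ps; rewrite /lerp /= le_eqVlt => /predU1P[<- _|t0 t1]; first lra.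
  (* The coordinate sum of the point is [(2 - t) + t * (p.1 + p.2 - 1)], and [2 - t] is at least
     1. *)
  have : 0 < t * (p.1 + p.2 - 1) by apply: mulr_gt0; lra.
  lra.
Qed.

Lemma frontier_tri0 : frontier tri0 = bd0.
Proof.
rewrite /frontier (iffLR (interior_id _) open_tri0).
have -> : closure tri0 = [set p | [/\ 0 <= p.1, 0 <= p.2 & p.1 + p.2 <= 1]].
  apply/seteqP; split => p.
    rewrite closureE; apply: smallest_sub; last by move=> q []; split; lra.
    rewrite (_ : mkset _ = [set p | 0 <= 1 * p.1 + 0 * p.2 + 0] `&`
      ([set p | 0 <= 0 * p.1 + 1 * p.2 + 0] `&`
       [set p | 0 <= (-1) * p.1 + (-1) * p.2 + 1])).
      by do 2?[apply: closedI; first exact: closed_halfplane];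
        exact: closed_halfplane.
    apply/seteqP; split => q /=; first by case=> *; do !split; lra.
    by case=> ? [? ?]; split; lra.
  (* [(1/4, 1/4)] is an interior point, so a segment from a boundary point towards it enters the
     open triangle at once. *)
  move=> [p1 p2 p3]; apply: (@closure_lerp _ (1/4, 1/4)) => t t0 t1.
  by split; rewrite /lerp /=; nra.
apply/seteqP; split => p /=.
  move=> [[p1 p2 p3] np]; split=> //.
  have [?|e1] := eqVneq p.1 0; first exact: Or31.
  have [?|e2] := eqVneq p.2 0; first exact: Or32.
  have [?|e3] := eqVneq (p.1 + p.2) 1; first exact: Or33.
  by case: np; split; rewrite lt_neqAle ?p1 ?p2 ?p3 ?e3 1?eq_sym ?e1 ?e2.
by move=> [p1 p2 p3 h]; split=> // -[q1 q2 q3]; case: h; lra.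
Qed.

Lemma frontier_ext0 : frontier ext0 = bd0.
Proof.
rewrite /frontier (iffLR (interior_id _) open_ext0).
have -> : closure ext0 = [set p | [\/ p.1 <= 0, p.2 <= 0 | 1 <= p.1 + p.2]].
  apply/seteqP; split => p.
    rewrite closureE; apply: smallest_sub; last first.
      by move=> q [] ?; [apply: Or31|apply: Or32|apply: Or33]; lra.
    rewrite (_ : mkset _ = [set p | 0 <= (-1) * p.1 + 0 * p.2 + 0] `|`
      ([set p | 0 <= 0 * p.1 + (-1) * p.2 + 0] `|`
       [set p | 0 <= 1 * p.1 + 1 * p.2 + (-1)])).
      by do 2?[apply: closedU; first exact: closed_halfplane];
        exact: closed_halfplane.
    apply/seteqP; split => q /=.
      by case=> *; [left|right; left|right; right]; lra.
    by case=> [?|[?|?]]; [apply: Or31|apply: Or32|apply: Or33]; lra.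
  (* Each target point lies in the open half-plane whose closure contains [p]. *)
  case=> h.
  - apply: (@closure_lerp _ (-1, 0)) => t t0 t1; apply: Or31.
    by rewrite /lerp /=; nra.
  - apply: (@closure_lerp _ (0, -1)) => t t0 t1; apply: Or32.
    by rewrite /lerp /=; nra.
  - apply: (@closure_lerp _ (2, 0)) => t t0 t1; apply: Or33.
    by rewrite /lerp /=; nra.
apply/seteqP; split => p /=.
  move=> [h np]; have [q1 q2 q3] : [/\ 0 <= p.1, 0 <= p.2 & p.1 + p.2 <= 1].
    by split; rewrite leNgt; apply/negP => ?; apply: np;
      [apply: Or31|apply: Or32|apply: Or33].
  by split=> //; case: h => ?; [apply: Or31|apply: Or32|apply: Or33]; lra.
move=> [p1 p2 p3 h]; split; last by case; lra.
by case: h => ?; [apply: Or31|apply: Or32|apply: Or33]; lra.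
Qed.

(** * Open and closed segments, and general triangles *)

(** The endpoints are left out so that vertices, edges and faces of a drawing can be pairwise
    disjoint. *)
Definition seg x y : set (R * R) := [set p | exists t, [/\ 0 < t, t < 1 & p = lerp x y t]].

Definition cseg x y : set (R * R) := lerp x y @` `[0, 1].

Lemma csegC x y : cseg x y = cseg y x.
Proof.
suff H a b : cseg a b `<=` cseg b a by apply/seteqP; split; exact: H.
move=> _ [t] /= + <-; rewrite in_itv /= => /andP[t0 t1]; rewrite lerpC.
by exists (1 - t) => //=; rewrite in_itv /=; apply/andP; split; lra.
Qed.

Lemma csegE x y p : cseg x y p <-> [\/ p = x, p = y | seg x y p].
Proof.
split.
  move=> [t] /= + <-; rewrite in_itv /= !le_eqVlt.
  move=> /andP[/orP[/eqP <-|t0] /orP[/eqP|t1]]; rewrite ?lerp0.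
  - by move=> _; apply: Or31.
  - by apply: Or31.
  - by move=> ->; apply: Or32; rewrite lerp1.
  - by apply: Or33; exists t.
case=> [->|->|[t [t0 t1 ->]]].
- by exists 0; rewrite ?lerp0//= in_itv /= lexx ler01.
- by exists 1; rewrite ?lerp1//= in_itv /= lexx ler01.
- by exists t => //=; rewrite in_itv /= !ltW.
Qed.

Lemma cseg_arc x y : x <> y -> is_arc x y (cseg x y).
Proof.
move=> xy; exists (lerp x y); split; rewrite ?lerp0 ?lerp1 //.
  exact/continuous_subspaceT/continuous_lerp.
move=> s t _ _ [/eqP e1 /eqP e2]; apply: contrapT => /eqP st; apply: xy.
have {}e1 : (s - t) * (y.1 - x.1) = 0 by move/eqP: e1; lra.
have {}e2 : (s - t) * (y.2 - x.2) = 0 by move/eqP: e2; lra.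
move/eqP: e1; rewrite mulf_eq0 !subr_eq0 (negPf st) /= => /eqP e1.
move/eqP: e2; rewrite mulf_eq0 !subr_eq0 (negPf st) /= => /eqP e2.
by case: x y e1 e2 => ? ? [? ?] /= -> ->.
Qed.

Lemma image_cseg x y z p q :
  affm x y z @` cseg p q = cseg (affm x y z p) (affm x y z q).
Proof.
rewrite /cseg image_comp; congr (_ @` _).
by apply/funext => t; exact: affm_lerp.
Qed.

Lemma affm_corners x y z :
  [/\ affm x y z (1, 0) = x, affm x y z (0, 1) = y & affm x y z (0, 0) = z].
Proof.
by case: x y z => [? ?] [? ?] [? ?]; rewrite /affm /=;
  split; congr pair; ring.
Qed.

Lemma bd0E : bd0 = cseg (1, 0) (0, 1) `|` cseg (0, 1) (0, 0) `|` cseg (0, 0) (1, 0).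
Proof.
apply/seteqP; split => [[u v] /= [/= p1 p2 p3]|p].
  case=> h.
  - left; right; exists (1 - v); first by rewrite /= in_itv /=; apply/andP; split; lra.
    by rewrite /lerp /= h; congr pair; ring.
  - right; exists u; first by rewrite /= in_itv /=; apply/andP; split; lra.
    by rewrite /lerp /= h; congr pair; ring.
  - left; left; exists v; first by rewrite /= in_itv /=; apply/andP; split; lra.
    by rewrite /lerp /=; congr pair; lra.
by case=> [[|]|] [t] /=; rewrite in_itv /= => /andP[t0 t1] <-;
  split; rewrite /lerp /=; do ?[lra]; [apply: Or33|apply: Or31|apply: Or32]; lra.
Qed.

Definition tri x y z : set (R * R) := affm x y z @` tri0.

Lemma triE x y z p : dt x y z != 0 -> tri x y z p <-> tri0 (bary x y z p).
Proof.
move=> d0; split; first by move=> [q Tq <-]; rewrite affmK.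
by exists (bary x y z p) => //; rewrite baryK.
Qed.

Lemma open_tri x y z : dt x y z != 0 -> open (tri x y z).
Proof.
move=> d0; rewrite (_ : tri x y z = bary x y z @^-1` tri0).
  apply: open_comp; last exact: open_tri0.
  by move=> ? _; exact: continuous_bary.
by apply/seteqP; split => p /=; apply triE.
Qed.

Lemma connected_tri x y z : connected (tri x y z).
Proof.
apply: connected_continuous_connected; first exact: connected_tri0.
exact/continuous_subspaceT/continuous_affm.
Qed.

Lemma frontier_tri x y z : dt x y z != 0 ->
  frontier (tri x y z) = cseg x y `|` cseg y z `|` cseg z x.
Proof.
move=> d0; rewrite /tri (frontier_homeo _ (@continuous_affm x y z)
  (@continuous_bary x y z) (affmK d0) (baryK d0)) frontier_tri0 bd0E.
rewrite !image_setU !image_cseg.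
by have [-> -> ->] := affm_corners x y z.
Qed.

Lemma image_seg x y z p q r : seg p q r ->
  seg (affm x y z p) (affm x y z q) (affm x y z r).
Proof. by move=> [t [t0 t1 ->]]; exists t; split=> //; exact: affm_lerp. Qed.

Lemma seg_preim x y z p q r : seg (affm x y z p) (affm x y z q) r ->
  exists2 r', seg p q r' & r = affm x y z r'.
Proof.
move=> [t [t0 t1 ->]]; exists (lerp p q t); last by rewrite affm_lerp.
by exists t.
Qed.

Lemma image_tri x y z p q r w : tri p q r w ->
  tri (affm x y z p) (affm x y z q) (affm x y z r) (affm x y z w).
Proof. by move=> [u u0 <-]; exists u => //; rewrite affm_affm. Qed.

Lemma tri_preim x y z p q r w :
  tri (affm x y z p) (affm x y z q) (affm x y z r) w ->
  exists2 w', tri p q r w' & w = affm x y z w'.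
Proof.
move=> [u u0 <-]; exists (affm p q r u); last by rewrite affm_affm.
by exists u.
Qed.
End Plane.

(** * Triangulated triangles as combinatorial maps, and pasting *)

(* A triangulated triangle: vertices are [0 .. nv-1], of which 0, 1, 2 are the
   corners; every undirected edge is listed in one direction only; [fcs] lists
   the inner faces. *)
Record cmap := CMap {
  nv : nat;
  eds : seq (nat * nat);
  fcs : seq (nat * nat * nat) }.

Definition adjE (E : seq (nat * nat)) i j := ((i, j) \in E) || ((j, i) \in E).

Definition outer : seq (nat * nat) := [:: (0, 1); (1, 2); (0, 2)]%N.

(* When a map is pasted into the face [g] of a map with [n] vertices, its
   corners are identified with those of [g] and its other vertices are numbered
   from [n] on. *)
Definition loc n (g : nat * nat * nat) i : nat :=
  match i with 0 => g.1.1 | 1 => g.1.2 | 2 => g.2 | k.+3 => (n + k)%N end.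

Definition loc2 n g (e : nat * nat) := (loc n g e.1, loc n g e.2).

Definition loc3 n g (h : nat * nat * nat) :=
  (loc n g h.1.1, loc n g h.1.2, loc n g h.2).

(** The three corners and the outer edges of [P] are not copied, since they become corners and sides
    of [g]. *)
Definition insert (P s : cmap) g : cmap :=
  CMap (nv s + (nv P - 3))
    ([seq loc2 (nv s) g e | e <- eds P & e \notin outer] ++ eds s)
    ([seq loc3 (nv s) g h | h <- fcs P] ++ [seq h <- fcs s | h != g]).

(** * Straight-line drawings of maps *)

Section Drawing.
Variable R : realType.
Implicit Types (pos : nat -> R * R) (q : R * R).

Definition eseg pos (e : nat * nat) : set (R * R) := seg (pos e.1) (pos e.2).

Definition ftri pos (g : nat * nat * nat) : set (R * R) :=
  tri (pos g.1.1) (pos g.1.2) (pos g.2).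

(** Vertices, open edges, open inner faces and the exterior partition the plane; that edges and
    faces avoid the exterior follows from [dw_in] by convexity. The outer triangle is the standard
    one, so that [affm] carries the whole drawing into any face. *)
Record drawn (s : cmap) pos : Prop := Drawn {
  dw_out : [/\ (2 < nv s)%N, pos 0%N = (1, 0), pos 1%N = (0, 1), pos 2%N = (0, 0) &
    {subset outer <= eds s}];
  dw_inj : forall i j, (i < nv s)%N -> (j < nv s)%N -> pos i = pos j -> i = j;
  dw_in : forall k, (k < nv s)%N -> ~ ext0 (pos k);
  dw_edge : forall e, e \in eds s -> (e.1 < nv s)%N /\ (e.2 < nv s)%N;
  dw_ev : forall e k, e \in eds s -> (k < nv s)%N -> ~ eseg pos e (pos k);
  dw_ee : forall e e' q, e \in eds s -> e' \in eds s -> e <> e' ->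
    eseg pos e q -> ~ eseg pos e' q;
  dw_face : forall g, g \in fcs s ->
    [/\ (g.1.1 < nv s)%N, (g.1.2 < nv s)%N, (g.2 < nv s)%N &
        dt (pos g.1.1) (pos g.1.2) (pos g.2) != 0];
  dw_fadj : forall g, g \in fcs s ->
    [/\ adjE (eds s) g.1.1 g.1.2, adjE (eds s) g.1.2 g.2 & adjE (eds s) g.2 g.1.1];
  dw_fv : forall g k, g \in fcs s -> (k < nv s)%N -> ~ ftri pos g (pos k);
  dw_fe : forall g e q, g \in fcs s -> e \in eds s -> ftri pos g q -> ~ eseg pos e q;
  dw_ff : forall g h q, g \in fcs s -> h \in fcs s -> g <> h ->
    ftri pos g q -> ~ ftri pos h q;
  dw_cov : forall q, [\/ ext0 q, exists2 k, (k < nv s)%N & q = pos k,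
    exists2 e, e \in eds s & eseg pos e q | exists2 g, g \in fcs s & ftri pos g q] }.

Lemma ext0PN q : ~ ext0 q <-> [/\ 0 <= q.1, 0 <= q.2 & q.1 + q.2 <= 1].
Proof.
split; last by move=> [? ? ?] []; lra.
by move=> nq; split; rewrite leNgt; apply/negP => ?; apply: nq;
  [apply: Or31|apply: Or32|apply: Or33].
Qed.

Lemma tri0PN q : ~ ext0 q -> ~ bd0 q -> tri0 q.
Proof.
move=> /ext0PN[q1 q2 q3] nb.
by split; rewrite lt_neqAle ?q1 ?q2 ?q3 andbT; apply/eqP => h; apply: nb;
  split=> //; [apply: Or31|apply: Or32|apply: Or33].
Qed.

Lemma seg_ext0 (p q r : R * R) : ~ ext0 p -> ~ ext0 q -> seg p q r -> ~ ext0 r.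
Proof.
move=> /ext0PN[p1 p2 p3] /ext0PN[q1 q2 q3] [t [t0 t1 ->]].
by apply/ext0PN; rewrite /lerp; split => /=; nra.
Qed.

Lemma tri_ext0 (x y z w : R * R) : ~ ext0 x -> ~ ext0 y -> ~ ext0 z ->
  tri x y z w -> ~ ext0 w.
Proof.
move=> /ext0PN[x1 x2 x3] /ext0PN[y1 y2 y3] /ext0PN[z1 z2 z3] [[u v] /= [/= u0 v0 uv]] <-.
(* Once the nonnegative weights are multiplied into the constraints on the corners, the claim is
   linear. *)
have w0 : 0 <= 1 - u - v by lra.
have := mulr_ge0 (ltW u0) x1; have := mulr_ge0 (ltW u0) x2.
have := mulr_ge0 (ltW v0) y1; have := mulr_ge0 (ltW v0) y2.
have := mulr_ge0 w0 z1; have := mulr_ge0 w0 z2.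
have := ler_wpM2l (ltW u0) x3; have := ler_wpM2l (ltW v0) y3.
have := ler_wpM2l w0 z3.
by move=> *; apply/ext0PN; rewrite /affm; split => /=; lra.
Qed.

Lemma bd0_outer (r : nat -> R * R) q :
  r 0%N = (1, 0) -> r 1%N = (0, 1) -> r 2%N = (0, 0) -> bd0 q ->
  (exists2 k, (k < 3)%N & q = r k) \/ (exists2 e, e \in outer & eseg r e q).
Proof.
move=> r0 r1 r2; rewrite bd0E -r0 -r1 -r2 [cseg (r 2%N) _]csegC.
by case=> [[|]|] /csegE[->|->|sq];
  [left; exists 0%N|left; exists 1%N|right; exists (0, 1)%N
  |left; exists 1%N|left; exists 2%N|right; exists (1, 2)%N
  |left; exists 0%N|left; exists 2%N|right; exists (0, 2)%N].
Qed.

Section Reference.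
Variables (P : cmap) (r : nat -> R * R).
Hypothesis dP : drawn P r.

Lemma drawn_bd0 q : bd0 q -> (exists2 k, (k < 3)%N & q = r k) \/
  (exists2 e, e \in outer & eseg r e q).
Proof. by have [_ r0 r1 r2 _] := dw_out dP; exact: bd0_outer. Qed.

(** Convexity keeps the drawing in the closed triangle, and its boundary is taken up by the outer
    corners and edges, from which all other vertices are disjoint. The same argument places the
    remaining edges and the faces in the open triangle. *)
Lemma drawn_vertex_tri0 k : (2 < k < nv P)%N -> tri0 (r k).
Proof.
move=> /andP[k2 kP]; apply: tri0PN; first exact: (dw_in dP).
have [n2 _ _ _ sub] := dw_out dP.
move=> /drawn_bd0[[j j3]|[e eo]].
  by move/(dw_inj dP kP (leq_trans j3 n2)) => kj; lia.
exact: (dw_ev dP (sub _ eo)) kP.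
Qed.

Lemma drawn_edge_ext0 e q : e \in eds P -> eseg r e q -> ~ ext0 q.
Proof.
by move=> eP; have [? ?] := dw_edge dP eP; apply: seg_ext0; exact: (dw_in dP).
Qed.

Lemma drawn_face_ext0 g q : g \in fcs P -> ftri r g q -> ~ ext0 q.
Proof.
by move=> gP; have [? ? ? _] := dw_face dP gP; apply: tri_ext0; exact: (dw_in dP).
Qed.

Lemma drawn_edge_tri0 e q : e \in eds P -> e \notin outer -> eseg r e q -> tri0 q.
Proof.
move=> eP eo sq; apply: tri0PN; first exact: drawn_edge_ext0 sq.
have [n2 _ _ _ sub] := dw_out dP.
move=> /drawn_bd0[[j j3 qj]|[e' eo']].
  by rewrite qj in sq; apply: (dw_ev dP eP _ sq); exact: leq_trans n2.
apply: (dw_ee dP eP (sub _ eo')) sq => ee.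
by rewrite ee eo' in eo.
Qed.

Lemma drawn_face_tri0 g q : g \in fcs P -> ftri r g q -> tri0 q.
Proof.
move=> gP tq; apply: tri0PN; first exact: drawn_face_ext0 tq.
have [n2 _ _ _ sub] := dw_out dP.
move=> /drawn_bd0[[j j3 qj]|[e' eo']].
  by rewrite qj in tq; apply: (dw_fv dP gP _ tq); exact: leq_trans n2.
exact: (dw_fe dP gP (sub _ eo')) tq.
Qed.

Lemma outer_bd0 e q : e \in outer -> eseg r e q -> bd0 q.
Proof.
have [_ r0 r1 r2 _] := dw_out dP.
rewrite !inE /eseg => /or3P[] /eqP-> /=; rewrite ?r0 ?r1 ?r2 => -[t [t0 t1 ->]] {r0 r1 r2};
  rewrite /lerp; split => /=; try lra; [apply: Or33|apply: Or31|apply: Or32]; lra.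
Qed.

(** Of the regions in [dw_cov], the exterior, the corners and the outer edges do not meet the open
    triangle. *)
Lemma drawn_cov_tri0 q : tri0 q -> [\/ exists2 k, (2 < k < nv P)%N & q = r k,
  exists e, [/\ e \in eds P, e \notin outer & eseg r e q] |
  exists2 g, g \in fcs P & ftri r g q].
Proof.
move=> tq; have [q1 q2 q3] := tq.
have [_ r0 r1 r2 _] := dw_out dP.
have nb : ~ bd0 q by clear -q1 q2 q3; move=> [_ _ _ []]; lra.
case: (dw_cov dP q) => [eq|[k kP qk]|[e eP eq]|[g gP gq]].
- by case: eq; clear -q1 q2 q3; lra.
- apply: Or31; exists k => //; rewrite kP andbT ltnNge; apply/negP => k2.
  case: k k2 {kP} qk => [|[|[|//]]] _ qk;
  by rewrite qk ?r0 ?r1 ?r2 /= in q1 q2 q3; clear -q1 q2 q3; lra.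
- apply: Or32; exists e; split=> //; apply/negP => eo; apply: nb.
  exact: outer_bd0 eo eq.
- by apply: Or33; exists g.
Qed.

End Reference.

Lemma adjE_sym E i j : adjE E i j = adjE E j i.
Proof. exact: orbC. Qed.

(** * Pasting a drawing into a face of another one *)

Section Insertion.
Variables (P s : cmap) (r pos : nat -> R * R) (g : nat * nat * nat).
Hypotheses (dP : drawn P r) (ds : drawn s pos) (gs : g \in fcs s).

Let A := affm (pos g.1.1) (pos g.1.2) (pos g.2).

Definition insert_pos k := if (k < nv s)%N then pos k else A (r (k - nv s).+3).

Let Ainj : injective A.
Proof. by have [_ _ _ d0] := dw_face ds gs; exact: can_inj (affmK d0). Qed.

Let inA q : tri0 q -> ftri pos g (A q).
Proof. by exists q. Qed.

Let pos_old k : (k < nv s)%N -> insert_pos k = pos k.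
Proof. by rewrite /insert_pos => ->. Qed.

(** This covers the corners too, since [A] maps the standard corners to those of [g]; all vertices
    of [P] can then be treated alike. *)
Let pos_new i : (i < nv P)%N -> insert_pos (loc (nv s) g i) = A (r i).
Proof.
have [g1 g2 g3 _] := dw_face ds gs; have [_ r0 r1 r2 _] := dw_out dP.
have [A0 A1 A2] : [/\ A (1, 0) = pos g.1.1, A (0, 1) = pos g.1.2 &
    A (0, 0) = pos g.2] by exact: affm_corners.
move: i => [|[|[|i]]] iP /=.
- by rewrite pos_old // r0 A0.
- by rewrite pos_old // r1 A1.
- by rewrite pos_old // r2 A2.
by rewrite /insert_pos ltnNge leq_addr /= addKn.
Qed.

Let new_vertex k : (k < nv s + (nv P - 3))%N -> (nv s <= k)%N ->
  exists2 i, (2 < i < nv P)%N & k = loc (nv s) g i.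
Proof. by move=> h1 h2; exists (k - nv s).+3 => /=; lia. Qed.

Let loc_lt i : (i < nv P)%N -> (loc (nv s) g i < nv s + (nv P - 3))%N.
Proof.
have [g1 g2 g3 _] := dw_face ds gs.
move: i => [|[|[|i]]] iP /=; first exact: ltn_addr.
- exact: ltn_addr.
- exact: ltn_addr.
by rewrite ltn_add2l; lia.
Qed.

Let seg_old e : e \in eds s -> eseg insert_pos e = eseg pos e.
Proof. by move=> /(dw_edge ds)[e1 e2]; rewrite /eseg !pos_old. Qed.

Let seg_new e q : e \in eds P -> eseg insert_pos (loc2 (nv s) g e) q ->
  exists2 q', eseg r e q' & q = A q'.
Proof.
move=> /(dw_edge dP)[e1 e2]; rewrite /eseg /loc2 /= !pos_new //.
exact: seg_preim.
Qed.

Let tri_old h : h \in fcs s -> ftri insert_pos h = ftri pos h.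
Proof. by move=> /(dw_face ds)[h1 h2 h3 _]; rewrite /ftri !pos_old. Qed.

Let tri_new h q : h \in fcs P -> ftri insert_pos (loc3 (nv s) g h) q ->
  exists2 q', ftri r h q' & q = A q'.
Proof.
move=> /(dw_face dP)[h1 h2 h3 _]; rewrite /ftri /loc3 /= !pos_new //.
exact: tri_preim.
Qed.

Let edsP (Q : nat * nat -> Prop) : (forall e, e \in eds s -> Q e) ->
  (forall e, e \in eds P -> e \notin outer -> Q (loc2 (nv s) g e)) ->
  forall e, e \in eds (insert P s g) -> Q e.
Proof.
move=> Qs QP e; rewrite mem_cat => /orP[/mapP[e']|/Qs //].
by rewrite mem_filter => /andP[? ?] ->; exact: QP.
Qed.

Let fcsP (Q : nat * nat * nat -> Prop) : (forall h, h \in fcs s -> h != g -> Q h) ->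
  (forall h, h \in fcs P -> Q (loc3 (nv s) g h)) ->
  forall h, h \in fcs (insert P s g) -> Q h.
Proof.
move=> Qs QP h; rewrite mem_cat => /orP[/mapP[h' h'P ->]|]; first exact: QP.
by rewrite mem_filter => /andP[? ?]; exact: Qs.
Qed.

Let nvP (Q : nat -> Prop) : (forall k, (k < nv s)%N -> Q k) ->
  (forall i, (2 < i < nv P)%N -> Q (loc (nv s) g i)) ->
  forall k, (k < nv (insert P s g))%N -> Q k.
Proof.
move=> Qs QP k /= kn; have [/Qs //|ks] := ltnP k (nv s).
by have [i ? ->] := new_vertex kn ks; exact: QP.
Qed.

Let vertex_in i : (2 < i < nv P)%N ->
  exists2 q, tri0 q & insert_pos (loc (nv s) g i) = A q.
Proof.
move=> iP; exists (r i); first exact: (drawn_vertex_tri0 dP).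
by apply: pos_new; case/andP: iP.
Qed.

Let adj_new i j : adjE (eds P) i j ->
  adjE (eds (insert P s g)) (loc (nv s) g i) (loc (nv s) g j).
Proof.
suff H a b : (a, b) \in eds P ->
    adjE (eds (insert P s g)) (loc (nv s) g a) (loc (nv s) g b).
  by move=> /orP[/H //|/H]; rewrite adjE_sym.
move=> abP; have [abo|abo] := boolP ((a, b) \in outer); last first.
  rewrite /adjE mem_cat; apply/orP; left; apply/orP; left.
  by apply/mapP; exists (a, b) => //; rewrite mem_filter abo.
(* An outer edge of [P] is not copied, but its image is a side of [g] and so an edge of [s]. *)
have [g1 g2 g3] := dw_fadj ds gs; rewrite adjE_sym in g3.
have adj_old i' j' : adjE (eds s) i' j' -> adjE (eds (insert P s g)) i' j'.
  by rewrite /adjE !mem_cat => /orP[] ->; rewrite !orbT.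
by move: abo; rewrite !inE => /or3P[] /eqP[-> ->] /=; exact: adj_old.
Qed.

(** Each disjointness clause splits into old and new objects. Two old ones are settled by [ds], two
    new ones by [dP] and injectivity of [A]. In a mixed pair the new object lies in the open face
    [g] and the old one outside it. *)
Lemma insert_drawn : drawn (insert P s g) insert_pos.
Proof.
have [g1 g2 g3 d0] := dw_face ds gs.
have [n2 r0 r1 r2 subP] := dw_out dP; have [s2 p0 p1 p2 subs] := dw_out ds.
split.
- split => /=; rewrite ?pos_old //; try lia.
  by move=> e /subs es; rewrite mem_cat es orbT.
- move=> i j iE; move: j; apply: nvP => [j js|j jP]; move: i iE; apply: nvP.
  + by move=> i is_; rewrite !pos_old //; exact: (dw_inj ds).
  + move=> i iP; have [q tq ->] := vertex_in iP; rewrite pos_old // => e.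
    by case: (dw_fv ds gs js); rewrite -e; exact: inA.
  + move=> i is_; have [q tq ->] := vertex_in jP; rewrite pos_old // => e.
    by case: (dw_fv ds gs is_); rewrite e; exact: inA.
  + move=> i /andP[_ iP]; case/andP: jP => _ jP.
    by rewrite !pos_new // => /Ainj /(dw_inj dP iP jP) ->.
- apply: nvP => [k ks|k kP]; first by rewrite pos_old //; exact: (dw_in ds).
  have [q tq ->] := vertex_in kP; apply: (drawn_face_ext0 ds gs); exact: inA.
- apply: edsP => [e /(dw_edge ds)[? ?] /=|e /(dw_edge dP)[? ?] _ /=].
    by split; exact: ltn_addr.
  by split; exact: loc_lt.
- move=> e k eE; move: k; apply: nvP => [k ks|k kP]; move: e eE; apply: edsP.
  + by move=> e es; rewrite seg_old // pos_old //; exact: (dw_ev ds).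
  + move=> e eP eo /seg_new[//|q' sq']; rewrite pos_old // => e'.
    apply: (dw_fv ds gs ks); rewrite e'; apply: inA.
    exact: (drawn_edge_tri0 dP eP eo).
  + move=> e es; rewrite seg_old //; have [q tq ->] := vertex_in kP.
    by apply: (dw_fe ds gs es); exact: inA.
  + move=> e eP eo /seg_new[//|q' sq']; case/andP: kP => _ kP.
    by rewrite pos_new // => /Ainj e'; apply: (dw_ev dP eP kP); rewrite e'.
- move=> e e' q eE; move: e'; apply: edsP => [e' es'|e' eP' eo']; move: e eE; apply: edsP.
  + by move=> e es; rewrite !seg_old //; exact: (dw_ee ds).
  + move=> e eP eo _ /seg_new[//|q' sq' ->]; rewrite seg_old //.
    by apply: (dw_fe ds gs es'); apply: inA; exact: (drawn_edge_tri0 dP eP eo).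
  + move=> e es _; rewrite seg_old // => sq /seg_new[//|q' sq' eq].
    apply: (dw_fe ds gs es _ sq); rewrite eq; apply: inA.
    exact: (drawn_edge_tri0 dP eP' eo').
  + move=> e eP eo ne /seg_new[//|q' sq' ->] /seg_new[//|q'' sq'' /Ainj eq].
    rewrite -{q''}eq in sq''; apply: (dw_ee dP eP eP' _ sq' sq'') => ee.
    by apply: ne; rewrite ee.
- apply: fcsP => [h hs hg|h hP /=].
    by have [? ? ? ?] := dw_face ds hs; rewrite !pos_old //; split => //=; exact: ltn_addr.
  have [h1 h2 h3 dh] := dw_face dP hP; split; do ?exact: loc_lt.
  by rewrite !pos_new // dt_affm mulf_neq0.
- apply: fcsP => [h hs hg|h hP].
    have [h1 h2 h3] := dw_fadj ds hs; rewrite /adjE !mem_cat.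
    by split; [move/orP: h1|move/orP: h2|move/orP: h3] => -[] ->; rewrite !orbT.
  by have [? ? ?] := dw_fadj dP hP; split; exact: adj_new.
- move=> h k hE; move: k; apply: nvP => [k ks|k kP]; move: h hE; apply: fcsP.
  + by move=> h hs _; rewrite tri_old // pos_old //; exact: (dw_fv ds).
  + move=> h hP /tri_new[//|q' tq']; rewrite pos_old // => e.
    apply: (dw_fv ds gs ks); rewrite e; apply: inA.
    exact: (drawn_face_tri0 dP hP).
  + move=> h hs /eqP hg; rewrite tri_old //; have [q tq ->] := vertex_in kP.
    by apply: (dw_ff ds gs hs) (inA tq) => // gh; apply: hg.
  + move=> h hP /tri_new[//|q' tq']; case/andP: kP => _ kP.
    by rewrite pos_new // => /Ainj e; apply: (dw_fv dP hP kP); rewrite e.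
- move=> h e q hE; move: e; apply: edsP => [e es|e eP eo]; move: h hE; apply: fcsP.
  + by move=> h hs _; rewrite tri_old // seg_old //; exact: (dw_fe ds).
  + move=> h hP /tri_new[//|q' tq' ->]; rewrite seg_old //.
    by apply: (dw_fe ds gs es); apply: inA; exact: (drawn_face_tri0 dP hP).
  + move=> h hs /eqP hg; rewrite tri_old // => tq /seg_new[//|q' sq' eq].
    apply: (dw_ff ds hs gs hg tq); rewrite eq; apply: inA.
    exact: (drawn_edge_tri0 dP eP eo).
  + move=> h hP /tri_new[//|q' tq' ->] /seg_new[//|q'' sq'' /Ainj eq].
    by rewrite -{q''}eq in sq''; exact: (dw_fe dP hP eP tq' sq'').
- move=> h h' q hE; move: h'; apply: fcsP => [h' hs' hg'|h' hP']; move: h hE; apply: fcsP.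
  + by move=> h hs _; rewrite !tri_old //; exact: (dw_ff ds).
  + move=> h hP _ /tri_new[//|q' tq' ->]; rewrite tri_old //.
    apply: (dw_ff ds gs hs').
      by move=> e; rewrite e eqxx in hg'.
    by apply: inA; exact: (drawn_face_tri0 dP hP).
  + move=> h hs /eqP hg _; rewrite tri_old // => tq /tri_new[//|q' tq' eq].
    apply: (dw_ff ds hs gs hg tq); rewrite eq; apply: inA.
    exact: (drawn_face_tri0 dP hP').
  + move=> h hP ne /tri_new[//|q' tq' ->] /tri_new[//|q'' tq'' /Ainj eq].
    rewrite -{q''}eq in tq''; apply: (dw_ff dP hP hP' _ tq' tq'') => ee.
    by apply: ne; rewrite ee.
- move=> q; case: (dw_cov ds q) => [?|[k ks ->]|[e es eq]|[h hs hq]].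
  + exact: Or41.
  + by apply: Or42; exists k; rewrite ?pos_old //=; exact: ltn_addr.
  + by apply: Or43; exists e; rewrite ?seg_old // mem_cat es orbT.
  have [hg|hg] := eqVneq h g; last first.
    by apply: Or44; exists h; rewrite ?tri_old // mem_cat mem_filter hg hs orbT.
  (* The face that disappears is covered by the image of the pasted drawing. *)
  move: hq; rewrite hg => -[q' tq' <-]; rewrite -/A.
  case: (drawn_cov_tri0 dP tq') => [[k kP ->]|[e [eP eo eq]]|[f fP fq]].
  + case/andP: (kP) => k2 kP'; apply: Or42.
    by exists (loc (nv s) g k); [exact: loc_lt|rewrite pos_new].
  + apply: Or43; exists (loc2 (nv s) g e).
      by rewrite mem_cat map_f // mem_filter eo.
    have [? ?] := dw_edge dP eP; rewrite /eseg /= !pos_new //.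
    exact: image_seg.
  + apply: Or44; exists (loc3 (nv s) g f); first by rewrite mem_cat map_f.
    have [? ? ? _] := dw_face dP fP; rewrite /ftri /= !pos_new //.
    exact: image_tri.
Qed.

End Insertion.

(** * Verification of the two small drawings *)

(** Apart from the open triangle there are only the exterior and the boundary, which consists of
    corners and outer edges. In a concrete drawing only interior points remain to be located. *)
Lemma tri0_cov (P : cmap) (r : nat -> R * R) :
  r 0%N = (1, 0) -> r 1%N = (0, 1) -> r 2%N = (0, 0) ->
  (2 < nv P)%N -> {subset outer <= eds P} ->
  (forall q, tri0 q -> [\/ exists2 k, (k < nv P)%N & q = r k,
    exists2 e, e \in eds P & eseg r e q | exists2 g, g \in fcs P & ftri r g q]) ->
  forall q, [\/ ext0 q, exists2 k, (k < nv P)%N & q = r k,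
    exists2 e, e \in eds P & eseg r e q | exists2 g, g \in fcs P & ftri r g q].
Proof.
move=> r0 r1 r2 n2 sub cov q.
have [|nq] := pselect (ext0 q); first exact: Or41.
have [|nb] := pselect (bd0 q); last first.
  by case: (cov q) => [|? |? |?]; [exact: tri0PN|exact: Or42|exact: Or43|exact: Or44].
move=> /(bd0_outer r0 r1 r2)[[k k3 ->]|[e eo eq]].
  by apply: Or42; exists k => //; exact: leq_trans n2.
by apply: Or43; exists e => //; exact: sub.
Qed.

(** Over an explicit list the conjunction unfolds by computation, so a quantified claim becomes
    finitely many goals. *)
Lemma foldr_mem (T : eqType) (Q : T -> Prop) (l : seq T) :
  foldr (fun x B => Q x /\ B) True l -> forall x, x \in l -> Q x.
Proof.
elim: l => //= a l IH [Qa Ql] x; rewrite inE => /predU1P[->//|].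
exact: IH.
Qed.

(** Each unordered pair is listed once, which suffices for a symmetric relation. *)
Fixpoint pairs_conj (T : Type) (Q : T -> T -> Prop) (l : seq T) : Prop :=
  if l is x :: l' then foldr (fun y B => Q x y /\ B) (pairs_conj Q l') l' else True.

Lemma pairs_conj_mem (T : eqType) (Q : T -> T -> Prop) (l : seq T) :
  (forall x y, Q x y -> Q y x) -> pairs_conj Q l ->
  forall x y, x \in l -> y \in l -> x <> y -> Q x y.
Proof.
have split_foldr (S : T -> Prop) (B : Prop) k :
    foldr (fun y B => S y /\ B) B k -> (forall y, y \in k -> S y) /\ B.
  elim: k => //= a k IH [Sa /IH[Sk HB]]; split=> // y.
  by rewrite inE => /predU1P[->//|]; exact: Sk.
move=> symQ; elim: l => //= a l IH /split_foldr[Qa /IH{}IH] x y.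
rewrite !inE => /predU1P[->|xl] /predU1P[->|yl] // ne.
- exact: Qa.
- exact/symQ/Qa.
- exact: IH.
Qed.

Lemma foldr_ltn (Q : nat -> Prop) n :
  foldr (fun x B => Q x /\ B) True (iota 0 n) -> forall k, (k < n)%N -> Q k.
Proof. by move=> /foldr_mem H k kn; apply: H; rewrite mem_iota. Qed.
End Drawing.

Ltac each := first [apply: foldr_mem | apply: foldr_ltn]; rewrite /=; do !split.

Definition stack_map : cmap := CMap 4
  (outer ++ [:: (0, 3); (1, 3); (2, 3)])
  [:: (0, 1, 3); (0, 2, 3); (1, 2, 3)].

Definition oct_map : cmap := CMap 6
  (outer ++ [:: (1, 3); (2, 3); (0, 4); (2, 4); (0, 5); (1, 5); (3, 4); (4, 5); (3, 5)])
  [:: (3, 4, 5); (0, 4, 5); (1, 3, 5); (2, 3, 4); (1, 2, 3); (0, 2, 4); (0, 1, 5)].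

Definition stack_pos (R : realType) : nat -> R * R :=
  nth (0, 0) [:: (1, 0); (0, 1); (0, 0); (1/3, 1/3)].

(** The vertices 3, 4, 5 are d, e, f, each missing one of the corners 0, 1, 2 in this order. Their
    barycentric coordinates are 1/5 at the missed corner and 2/5 at the other two. *)
Definition oct_pos (R : realType) : nat -> R * R :=
  nth (0, 0) [:: (1, 0); (0, 1); (0, 0); (1/5, 2/5); (2/5, 1/5); (2/5, 2/5)].

Ltac in_edge e t :=
  apply: Or32; exists e => //; exists t; split; [lra|lra|];
  rewrite /lerp /=; congr pair; lra.

Ltac in_face g u v :=
  apply: Or33; exists g => //; exists (u, v); [split => /=; lra|];
  rewrite /affm /=; congr pair; lra.

(** The face containing a point is opposite to the corner with the smallest of the barycentric
    coordinates [a], [b], [c]; ties for the minimum give edges or the centre. Subtracting the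
    minimum yields the coordinates in that face. *)
Lemma stack_cov (R : realType) (q : R * R) : tri0 q ->
  [\/ exists2 k, (k < nv stack_map)%N & q = stack_pos R k,
    exists2 e, e \in eds stack_map & eseg (stack_pos R) e q |
    exists2 g, g \in fcs stack_map & ftri (stack_pos R) g q].
Proof.
case: q => a b [/= a0 b0 ab]; have [c Ec] : exists c : R, c = 1 - a - b by exists (1 - a - b).
have [ac|ca|ac] := ltrgtP a c; have [bc|cb|bc] := ltrgtP b c.
- have [?|?|?] := ltrgtP a b.
  + in_face (1, 2, 3)%N (b - a) (c - a).
  + in_face (0, 2, 3)%N (a - b) (c - b).
  + in_edge (2, 3)%N (3 * a).
- in_face (1, 2, 3)%N (b - a) (c - a).
- in_face (1, 2, 3)%N (b - a) (c - a).
- in_face (0, 2, 3)%N (a - b) (c - b).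
- in_face (0, 1, 3)%N (a - c) (b - c).
- in_edge (0, 3)%N (3 * b).
- in_face (0, 2, 3)%N (a - b) (c - b).
- in_edge (1, 3)%N (3 * a).
- by apply: Or31; exists 3%N => //=; congr pair; lra.
Qed.

(* A point or a region with numeric corners is described by linear constraints,
   so each disjointness claim about a concrete map is a linear problem. *)
Lemma stack_ev (R : realType) e k : e \in eds stack_map -> (k < nv stack_map)%N ->
  ~ eseg (stack_pos R) e (stack_pos R k).
Proof.
move=> eP; move: k; each; move: e eP; each; move=> [t [t0 t1 []]] /=; lra.
Qed.

Lemma stack_ee (R : realType) e e' q : e \in eds stack_map -> e' \in eds stack_map ->
  e <> e' -> eseg (stack_pos R) e q -> ~ eseg (stack_pos R) e' q.
Proof.
move=> eP e'P ne; move: q; move: e e' eP e'P ne.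
apply: pairs_conj_mem => [e e' He q /[swap]|/=]; first exact: He.
by do !split; move=> q [t [t0 t1 ->]] [t' [t0' t1' []]] /=; lra.
Qed.

Lemma stack_fv (R : realType) g k : g \in fcs stack_map -> (k < nv stack_map)%N ->
  ~ ftri (stack_pos R) g (stack_pos R k).
Proof.
move=> gP; move: k; each; move: g gP; each;
  move=> [[u v] /= [/= u0 v0 uv] []]; lra.
Qed.

Lemma stack_fe (R : realType) g e q : g \in fcs stack_map -> e \in eds stack_map ->
  ftri (stack_pos R) g q -> ~ eseg (stack_pos R) e q.
Proof.
move=> gP; move: e; each; move: g gP; each;
  move=> [[u v] /= [/= u0 v0 uv] <-] [t [t0 t1 []]] /=; lra.
Qed.

Lemma stack_ff (R : realType) g h q : g \in fcs stack_map -> h \in fcs stack_map ->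
  g <> h -> ftri (stack_pos R) g q -> ~ ftri (stack_pos R) h q.
Proof.
move=> gP hP gh; move: q; move: g h gP hP gh.
apply: pairs_conj_mem => [g h Hg q /[swap]|/=]; first exact: Hg.
by do !split; move=> q [[u v] /= [/= u0 v0 uv] <-];
  move=> [[u' v'] /= [/= u0' v0' uv'] []]; lra.
Qed.

Lemma stack_drawn (R : realType) : drawn stack_map (@stack_pos R).
Proof.
split.
- by split=> // e; rewrite mem_cat => ->.
- move=> i j ii; move: j; each; move: i ii; each => //; case=> *; exfalso; lra.
- each; case=> /=; lra.
- by each.
- exact: stack_ev.
- exact: stack_ee.
- apply: foldr_mem => /=.
  by do ?[split; first by split=> //; rewrite /dt /=; apply/eqP; lra].
- by each.
- exact: stack_fv.
- exact: stack_fe.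
- exact: stack_ff.
- apply: tri0_cov => // [e|q]; first by rewrite mem_cat => ->.
  exact: stack_cov.
Qed.

(** The line [a = 2/5] through 4 and 5 cuts off the corner 0; beyond it, the lines [c = 2 * b] and
    [b = 2 * c] from 0 through 4 and 5 separate three faces. The other corners are treated alike,
    and the closed central triangle remains. *)
Lemma oct_cov (R : realType) (q : R * R) : tri0 q ->
  [\/ exists2 k, (k < nv oct_map)%N & q = oct_pos R k,
    exists2 e, e \in eds oct_map & eseg (oct_pos R) e q |
    exists2 g, g \in fcs oct_map & ftri (oct_pos R) g q].
Proof.
case: q => a b [/= a0 b0 ab]; have [c Ec] : exists c : R, c = 1 - a - b by exists (1 - a - b).
have [a2|a2] := ltrP (2/5) a.
  have [?|?|?] := ltrgtP c (2 * b).
  - have [?|?|?] := ltrgtP b (2 * c).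
    + in_face (0, 4, 5)%N ((5 * a - 2) / 3) ((2 * c - b) * 5 / 3).
    + in_face (0, 1, 5)%N (a - 2 * c) (b - 2 * c).
    + in_edge (0, 5)%N (5 * c).
  - in_face (0, 2, 4)%N (a - 2 * b) (c - 2 * b).
  - in_edge (0, 4)%N (5 * b).
have [b2|b2] := ltrP (2/5) b.
  have [?|?|?] := ltrgtP c (2 * a).
  - have [?|?|?] := ltrgtP a (2 * c).
    + in_face (1, 3, 5)%N ((5 * b - 2) / 3) ((2 * c - a) * 5 / 3).
    + in_face (0, 1, 5)%N (a - 2 * c) (b - 2 * c).
    + in_edge (1, 5)%N (5 * c).
  - in_face (1, 2, 3)%N (b - 2 * a) (c - 2 * a).
  - in_edge (1, 3)%N (5 * a).
have [c2|c2] := ltrP (2/5) c.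
  have [?|?|?] := ltrgtP a (2 * b).
  - have [?|?|?] := ltrgtP b (2 * a).
    + in_face (2, 3, 4)%N ((5 * c - 2) / 3) ((2 * b - a) * 5 / 3).
    + in_face (1, 2, 3)%N (b - 2 * a) (c - 2 * a).
    + in_edge (2, 3)%N (5 * a).
  - in_face (0, 2, 4)%N (a - 2 * b) (c - 2 * b).
  - in_edge (2, 4)%N (5 * b).
(* On the central triangle one equality gives a side, two give a vertex, and three contradict
   [a + b + c = 1]. *)
move: a2 b2 c2; rewrite !le_eqVlt => /predU1P[a2|a2] /predU1P[b2|b2] /predU1P[c2|c2].
- by exfalso; lra.
- by apply: Or31; exists 5%N => //=; congr pair; lra.
- by apply: Or31; exists 4%N => //=; congr pair; lra.
- in_edge (4, 5)%N (5 * b - 1).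
- by apply: Or31; exists 3%N => //=; congr pair; lra.
- in_edge (3, 5)%N (5 * a - 1).
- in_edge (3, 4)%N (5 * a - 1).
- in_face (3, 4, 5)%N (2 - 5 * a) (2 - 5 * b).
Qed.

Lemma oct_ev (R : realType) e k : e \in eds oct_map -> (k < nv oct_map)%N ->
  ~ eseg (oct_pos R) e (oct_pos R k).
Proof.
move=> eP; move: k; each; move: e eP; each; move=> [t [t0 t1 []]] /=; lra.
Qed.

Lemma oct_ee (R : realType) e e' q : e \in eds oct_map -> e' \in eds oct_map ->
  e <> e' -> eseg (oct_pos R) e q -> ~ eseg (oct_pos R) e' q.
Proof.
move=> eP e'P ne; move: q; move: e e' eP e'P ne.
apply: pairs_conj_mem => [e e' He q /[swap]|/=]; first exact: He.
by do !split; move=> q [t [t0 t1 ->]] [t' [t0' t1' []]] /=; lra.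
Qed.

Lemma oct_fv (R : realType) g k : g \in fcs oct_map -> (k < nv oct_map)%N ->
  ~ ftri (oct_pos R) g (oct_pos R k).
Proof.
move=> gP; move: k; each; move: g gP; each;
  move=> [[u v] /= [/= u0 v0 uv] []]; lra.
Qed.

Lemma oct_fe (R : realType) g e q : g \in fcs oct_map -> e \in eds oct_map ->
  ftri (oct_pos R) g q -> ~ eseg (oct_pos R) e q.
Proof.
move=> gP; move: e; each; move: g gP; each;
  move=> [[u v] /= [/= u0 v0 uv] <-] [t [t0 t1 []]] /=; lra.
Qed.

Lemma oct_ff (R : realType) g h q : g \in fcs oct_map -> h \in fcs oct_map ->
  g <> h -> ftri (oct_pos R) g q -> ~ ftri (oct_pos R) h q.
Proof.
move=> gP hP gh; move: q; move: g h gP hP gh.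
apply: pairs_conj_mem => [g h Hg q /[swap]|/=]; first exact: Hg.
by do !split; move=> q [[u v] /= [/= u0 v0 uv] <-];
  move=> [[u' v'] /= [/= u0' v0' uv'] []]; lra.
Qed.

Lemma oct_drawn (R : realType) : drawn oct_map (@oct_pos R).
Proof.
split.
- by split=> // e; rewrite mem_cat => ->.
- move=> i j ii; move: j; each; move: i ii; each => //; case=> *; exfalso; lra.
- each; case=> /=; lra.
- by each.
- exact: oct_ev.
- exact: oct_ee.
- apply: foldr_mem => /=.
  by do ?[split; first by split=> //; rewrite /dt /=; apply/eqP; lra].
- by each.
- exact: oct_fv.
- exact: oct_fe.
- exact: oct_ff.
- apply: tri0_cov => // [e|q]; first by rewrite mem_cat => ->.
  exact: oct_cov.
Qed.

(** * From a drawn map to a plane triangulation *)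

Definition cadj (s : cmap) : rel 'I_(nv s) :=
  fun i j => (i != j) && adjE (eds s) i j.

Lemma cadj_sym s : symmetric (@cadj s).
Proof. by move=> i j; rewrite /cadj eq_sym adjE_sym. Qed.

Lemma cadj_irr s : irreflexive (@cadj s).
Proof. by move=> i; rewrite /cadj eqxx. Qed.

Definition cgraph (s : cmap) : sgraph := SGraph (@cadj_sym s) (@cadj_irr s).

Section PlaneGraphOfMap.
Variables (R : realType) (s : cmap) (pos : nat -> R * R).
Hypothesis ds : drawn s pos.

Let point_of (i : cgraph s) : R * R := pos (val i).
Let edge_of (i j : cgraph s) : set (R * R) := cseg (point_of i) (point_of j).

Lemma seg_of_adjE i j q : adjE (eds s) i j -> cseg (pos i) (pos j) q ->
  [\/ q = pos i, q = pos j | exists e, [/\ e \in eds s,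
    e = (i, j) \/ e = (j, i) & eseg pos e q]].
Proof.
case/orP => eE.
- move=> /csegE[->|->|sq]; [exact: Or31|exact: Or32|apply: Or33].
  by exists (i, j); split=> //; left.
- rewrite csegC => /csegE[->|->|sq]; [exact: Or32|exact: Or31|apply: Or33].
  by exists (j, i); split=> //; right.
Qed.

Lemma cpoint_inj : injective point_of.
Proof. by move=> i j /(dw_inj ds (ltn_ord i) (ltn_ord j))/val_inj. Qed.

Lemma cedge_arc (i j : cgraph s) : adj i j ->
  is_arc (point_of i) (point_of j) (edge_of i j).
Proof. by move=> /andP[/eqP ij _]; apply: cseg_arc => /cpoint_inj. Qed.

Lemma cedge_sym (i j : cgraph s) : adj i j -> edge_of i j = edge_of j i.
Proof. by move=> _; exact: csegC. Qed.

Lemma cedge_vertex (i j k : cgraph s) : adj i j ->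
  edge_of i j (point_of k) -> k = i \/ k = j.
Proof.
move=> /andP[_ ij] /(seg_of_adjE ij)[/cpoint_inj ->|/cpoint_inj ->|]; [by left|by right|].
by move=> [e [eE _]] /(dw_ev ds eE (ltn_ord k)).
Qed.

Lemma cedge_edge (i j i' j' : cgraph s) : adj i j -> adj i' j' ->
  [set i; j]%SET != [set i'; j']%SET ->
  (edge_of i j `\` [set point_of i; point_of j]) `&` edge_of i' j' = set0.
Proof.
move=> /andP[_ ij] /andP[_ ij'] ne; apply/seteqP; split=> // q [[qe nq] qe'].
case: (seg_of_adjE ij qe) => [qi|qj|[e [eE ee sq]]].
- by apply: nq; left.
- by apply: nq; right.
case: (seg_of_adjE ij' qe') => [qi|qj|[e' [eE' ee' sq']]].
- by move: sq; rewrite qi => /(dw_ev ds eE (ltn_ord i')).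
- by move: sq; rewrite qj => /(dw_ev ds eE (ltn_ord j')).
apply: (dw_ee ds eE eE' _ sq sq') => eq; case/eqP: ne.
by move: eq; case: ee => ->; case: ee' => -> [/val_inj -> /val_inj ->] //;
  rewrite finset.setUC.
Qed.

Definition cplane : plane_graph R :=
  PlaneGraph cpoint_inj cedge_arc cedge_sym cedge_vertex cedge_edge.

(** A loop would be a degenerate segment containing its own vertex, which [dw_ev] excludes. *)
Lemma adjE_neq i j : adjE (eds s) i j -> i != j.
Proof.
suff H a : (a, a) \notin eds s.
  by case/orP => h; apply: contraTneq h => ->; exact: H.
apply/negP => aE; have [a1 _] := dw_edge ds aE.
apply: (dw_ev ds aE a1); exists (1 / 2); split; [lra|lra|].
by rewrite /lerp; case: (pos a) => u v /=; congr pair; lra.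
Qed.

Lemma drawing_vertex k : (k < nv s)%N -> drawing cplane (pos k).
Proof. by move=> ks; left; exists (Ordinal ks). Qed.

Lemma drawing_cseg i j q : adjE (eds s) i j -> cseg (pos i) (pos j) q ->
  drawing cplane q.
Proof.
move=> ij qe; have [i_s js] : (i < nv s)%N /\ (j < nv s)%N.
  by case/orP: (ij) => /(dw_edge ds)[].
right; exists (Ordinal i_s), (Ordinal js); split => //.
by apply/andP; split; first exact: (adjE_neq ij).
Qed.

Lemma drawingP q : drawing cplane q ->
  (exists2 k, (k < nv s)%N & q = pos k) \/ (exists2 e, e \in eds s & eseg pos e q).
Proof.
case=> [[k ->]|[i [j [/andP[_ ij] qe]]]]; first by left; exists (val k); first exact: ltn_ord.
case: (seg_of_adjE ij qe) => [->|->|[e [eE _ sq]]].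
- by left; exists (val i); first exact: ltn_ord.
- by left; exists (val j); first exact: ltn_ord.
- by right; exists e.
Qed.

(** By [dw_cov], a point off the drawing lies in the exterior or in an inner face.
    [component_of_open] identifies its component with that region, whose frontier is a triangle of
    edges. *)
Lemma cplane_triangulation : planar_triangulation cplane.
Proof.
(* The frontier of an open [A] is its closure without [A], so computing it yields both the bounding
   triangle and a hypothesis of [component_of_open]. *)
have bounded (A : set (R * R)) i j k :
    adjE (eds s) i j -> adjE (eds s) j k -> adjE (eds s) k i ->
    frontier A = cseg (pos i) (pos j) `|` cseg (pos j) (pos k) `|` cseg (pos k) (pos i) ->
    open A -> bounded_by_triangle cplane A /\ closure A `\` A `<=` drawing cplane.
  move=> ij jk ki fA oA; split; last first.
    move=> q; rewrite -[X in _ `\` X](iffLR (interior_id _) oA).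
    move=> qA; have : frontier A q by [].
    by rewrite fA => -[[|]|]; exact: drawing_cseg.
  have [i_s js] : (i < nv s)%N /\ (j < nv s)%N.
    by case/orP: (ij) => /(dw_edge ds)[].
  have ks : (k < nv s)%N by case/orP: (ki) => /(dw_edge ds)[].
  exists (Ordinal i_s), (Ordinal js), (Ordinal ks); split => //;
    by apply/andP; split=> //; exact: adjE_neq.
move=> F [p np ->].
case: (dw_cov ds p) => [ep|[k ks pk]|[e eE pe]|[g gF pg]].
- have [_ p0 p1 p2 sub] := dw_out ds.
  have adj_out a b : (a, b) \in outer -> adjE (eds s) a b.
    by move=> /sub h; rewrite /adjE h.
  have [bA clA] : bounded_by_triangle cplane (@ext0 R) /\
      closure (@ext0 R) `\` @ext0 R `<=` drawing cplane.
    apply: (bounded _ 0%N 1%N 2%N); do ?exact: adj_out.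
    - by rewrite adjE_sym; exact: adj_out.
    - by rewrite frontier_ext0 bd0E p0 p1 p2.
    - exact: open_ext0.
  rewrite (component_of_open (@open_ext0 R) (@connected_ext0 R) _ clA ep) //.
  move=> q eq /drawingP[[k ks qk]|[e eE sq]].
    by apply: (dw_in ds ks); rewrite -qk.
  exact: (drawn_edge_ext0 ds eE sq eq).
- by case: np; rewrite pk; exact: drawing_vertex.
- case: np; apply: (@drawing_cseg e.1 e.2).
    by rewrite /adjE -surjective_pairing eE.
  by apply/csegE; apply: Or33.
- have [g1 g2 g3 d0] := dw_face ds gF; have [a1 a2 a3] := dw_fadj ds gF.
  have [bA clA] := bounded _ _ _ _ a1 a2 a3 (frontier_tri d0) (open_tri d0).
  rewrite (component_of_open (open_tri d0) (@connected_tri _ _ _ _) _ clA pg) //.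
  move=> q tq /drawingP[[k ks qk]|[e eE sq]].
    by apply: (dw_fv ds gF ks); rewrite -qk.
  exact: (dw_fe ds gF eE tq sq).
Qed.

End PlaneGraphOfMap.

(** * Bounds for independent dominating sets under insertion *)

(** Vertex sets are predicates on [nat], so that the same set can be tested in a map and in every
    map obtained from it by insertion. *)
Definition dominated (s : cmap) (S : pred nat) v :=
  S v \/ exists2 u, S u & adjE (eds s) v u.

Definition indep (s : cmap) (S : pred nat) :=
  forall i j, S i -> S j -> ~~ adjE (eds s) i j.

Definition edges_lt (s : cmap) :=
  forall i j, adjE (eds s) i j -> (i < nv s)%N && (j < nv s)%N.

(* The vertices in [W] need not be dominated, so the bound survives the
   insertion of further vertices into faces with corners in [W]. *)
Definition lower_bd (s : cmap) (W : seq nat) c :=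
  forall S : pred nat, indep s S ->
  (forall v, (v < nv s)%N -> v \notin W -> dominated s S v) ->
  (c <= count S (iota 0 (nv s)))%N.

Lemma adjE_cat E E' i j : adjE (E ++ E') i j = adjE E i j || adjE E' i j.
Proof. by rewrite /adjE !mem_cat; do ![case: (_ \in _) => //]. Qed.

Definition stack_eds (x y z n : nat) := [:: (x, n); (y, n); (z, n)].

(** The edges that an octahedron adds in the face [(x, y, z)], with d, e, f numbered [n], [n.+1],
    [n.+2]. *)
Definition oct_eds (x y z n : nat) :=
  [:: (y, n); (z, n); (x, n.+1); (z, n.+1); (x, n.+2); (y, n.+2);
      (n, n.+1); (n.+1, n.+2); (n, n.+2)].

Ltac adj_absurd :=
  apply/negP; let h := fresh in intro h; revert h;
  rewrite /adjE /stack_eds /oct_eds !inE !xpair_eqE;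
  repeat match goal with |- is_true (_ || _) -> _ => case/orP end;
  case/andP => /eqP ? /eqP ?; lia.

Section NewEdges.
Variables (x y z n u v : nat).
Hypotheses (xn : (x < n)%N) (yn : (y < n)%N) (zn : (z < n)%N).

Lemma stack_eds_old : (v < n)%N -> v != x -> v != y -> v != z ->
  ~~ adjE (stack_eds x y z n) v u.
Proof. by move=> ? ? ? ?; adj_absurd. Qed.

Lemma stack_eds_lt : (u < n)%N -> (v < n)%N -> ~~ adjE (stack_eds x y z n) u v.
Proof. by move=> ? ?; adj_absurd. Qed.

Lemma oct_eds_old : (v < n)%N -> v != x -> v != y -> v != z ->
  ~~ adjE (oct_eds x y z n) v u.
Proof. by move=> ? ? ? ?; adj_absurd. Qed.

Lemma oct_eds_lt : (u < n)%N -> (v < n)%N -> ~~ adjE (oct_eds x y z n) u v.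
Proof. by move=> ? ?; adj_absurd. Qed.

Lemma oct_eds0 : u != y -> u != z -> u != n.+1 -> u != n.+2 ->
  ~~ adjE (oct_eds x y z n) n u.
Proof. by move=> ? ? ? ?; adj_absurd. Qed.

Lemma oct_eds1 : u != x -> u != z -> u != n -> u != n.+2 ->
  ~~ adjE (oct_eds x y z n) n.+1 u.
Proof. by move=> ? ? ? ?; adj_absurd. Qed.

Lemma oct_eds2 : u != x -> u != y -> u != n -> u != n.+1 ->
  ~~ adjE (oct_eds x y z n) n.+2 u.
Proof. by move=> ? ? ? ?; adj_absurd. Qed.

End NewEdges.

Lemma mem_neq (T : eqType) (S : pred T) a b : S a -> ~~ S b -> a != b.
Proof. by move=> Sa; apply: contraNneq => <-. Qed.

Section Bounds.
Variables (s : cmap) (x y z : nat).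
Hypothesis s_lt : edges_lt s.
Hypotheses (xs : (x < nv s)%N) (ys : (y < nv s)%N) (zs : (z < nv s)%N).

Let n := nv s.

Lemma adjE_stack i j : adjE (eds (insert stack_map s (x, y, z))) i j =
  adjE (stack_eds x y z n) i j || adjE (eds s) i j.
Proof. by rewrite adjE_cat /= /loc2 /= addn0. Qed.

Lemma adjE_oct i j : adjE (eds (insert oct_map s (x, y, z))) i j =
  adjE (oct_eds x y z n) i j || adjE (eds s) i j.
Proof. by rewrite adjE_cat /= /loc2 /= addn0 addn1 addn2. Qed.

(** The neighbours [x], [y], [z] of the new vertex are exempt from domination, so it helps no old
    vertex that must be dominated; it becomes exempt itself. *)
Lemma stack_lower W c : {subset [:: x; y; z] <= W} -> lower_bd s W c ->
  lower_bd (insert stack_map s (x, y, z)) (n :: W) c.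
Proof.
move=> sW lb S iS dS; rewrite /= iotaD count_cat.
apply: leq_trans (leq_addr _ _); apply: lb => [i j Si Sj|v vn vW].
  by have := iS _ _ Si Sj; rewrite adjE_stack negb_or => /andP[].
have [||Sv|[u Su]] := dS v; [by rewrite /=; lia| |by left|].
  by rewrite inE negb_or vW andbT; lia.
rewrite adjE_stack => /orP[|vu]; last by right; exists u.
have nW w : w \in [:: x; y; z] -> v != w.
  by move=> /sW wW; apply: contraNneq vW => ->.
have := nW x; have := nW y; have := nW z; rewrite !inE !eqxx !orbT.
move=> /(_ isT) vz /(_ isT) vy /(_ isT) vx.
by rewrite (negPf (stack_eds_old _ xs ys zs vn vx vy vz)).
Qed.

(** Among the old vertices the new ones dominate only exempt corners, so the old part of [S] still
    has at least [c] elements. If no new vertex were in [S], each would need one of its two corners,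
    and two of the pairwise adjacent [x], [y], [z] would be in [S]. *)
Lemma oct_lower W c : {subset [:: x; y; z] <= W} -> (forall w, w \in W -> (w < n)%N) ->
  adjE (eds s) x y -> adjE (eds s) y z -> adjE (eds s) z x ->
  lower_bd s W c -> lower_bd (insert oct_map s (x, y, z)) W c.+1.
Proof.
move=> sW Wn xy yz zx lb S iS dS; rewrite /= iotaD count_cat -addn1.
have iSs i j : S i -> S j -> ~~ adjE (eds s) i j.
  by move=> Si Sj; have := iS _ _ Si Sj; rewrite adjE_oct negb_or => /andP[].
apply: leq_add.
  apply: lb => // v vn vW.
  have [||Sv|[u Su]] := dS v; [by rewrite /=; lia|by []|by left|].
  rewrite adjE_oct => /orP[|vu]; last by right; exists u.
  have nW w : w \in [:: x; y; z] -> v != w.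
    by move=> /sW wW; apply: contraNneq vW => ->.
  have := nW x; have := nW y; have := nW z; rewrite !inE !eqxx !orbT.
  move=> /(_ isT) vz /(_ isT) vy /(_ isT) vx.
  by rewrite (negPf (oct_eds_old _ xs ys zs vn vx vy vz)).
rewrite add0n /= -/n lt0n; apply/negP => /eqP c0.
have [S0 S1 S2] : [/\ ~~ S n, ~~ S n.+1 & ~~ S n.+2].
  by move: c0; case: (S n); case: (S n.+1); case: (S n.+2).
have newP v : (n <= v < n + 3)%N -> dominated (insert oct_map s (x, y, z)) S v.
  by move=> vn; apply: dS; [rewrite /=; lia|apply/negP => /Wn; lia].
have old v u : (n <= v)%N -> adjE (eds s) v u = false.
  by move=> nv; apply/negP => /s_lt/andP[]; lia.
have yzS : S y || S z.
  rewrite -[_ || _]negbK negb_or; apply/negP => /andP[Sa Sb].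
  case: (newP n); [lia|by rewrite (negPf S0)|move=> [u Su]].
  have ne w : ~~ S w -> u != w by exact: mem_neq.
  rewrite adjE_oct old ?orbF; last by lia.
  by apply/negP; apply: (oct_eds0 xs ys zs); exact: ne.
have xzS : S x || S z.
  rewrite -[_ || _]negbK negb_or; apply/negP => /andP[Sa Sb].
  case: (newP n.+1); [lia|by rewrite (negPf S1)|move=> [u Su]].
  have ne w : ~~ S w -> u != w by exact: mem_neq.
  rewrite adjE_oct old ?orbF; last by lia.
  by apply/negP; apply: (oct_eds1 xs ys zs); exact: ne.
have xyS : S x || S y.
  rewrite -[_ || _]negbK negb_or; apply/negP => /andP[Sa Sb].
  case: (newP n.+2); [lia|by rewrite (negPf S2)|move=> [u Su]].
  have ne w : ~~ S w -> u != w by exact: mem_neq.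
  rewrite adjE_oct old ?orbF; last by lia.
  by apply/negP; apply: (oct_eds2 xs ys zs); exact: ne.
have := iSs x y; have := iSs y z; have := iSs z x.
rewrite xy yz zx; move: xyS xzS yzS.
by case: (S x); case: (S y); case: (S z) => // _ _ _ h1 h2 h3;
  do ?[by have := h1 isT isT]; do ?[by have := h2 isT isT]; have := h3 isT isT.
Qed.

Definition upper_bd (s : cmap) (S : seq nat) :=
  [/\ uniq S, indep s (mem S) &
      forall v, (v < nv s)%N -> dominated s (mem S) v].

Lemma stack_upper S : all (fun v => (v < n)%N) S -> x \in S -> upper_bd s S ->
  upper_bd (insert stack_map s (x, y, z)) S.
Proof.
move=> Sn xS [uS iS dS]; split=> // [i j Si Sj|v].
  have := iS _ _ Si Sj; rewrite adjE_stack negb_or => ->; rewrite andbT.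
  exact: (stack_eds_lt xs ys zs (allP Sn _ Si) (allP Sn _ Sj)).
rewrite /= addn1 ltnS leq_eqVlt => /predU1P[->|/dS[Sv|[u Su vu]]].
- by right; exists x => //; rewrite adjE_stack /adjE /stack_eds !inE !xpair_eqE !eqxx !orbT.
- by left.
- by right; exists u => //; rewrite adjE_stack vu orbT.
Qed.

(** The vertex [n] is adjacent to both other new vertices and, among the old ones, only to [y] and
    [z]. It can therefore join [S] even if [x] belongs to [S]. *)
Lemma oct_upper S : all (fun v => (v < n)%N) S -> y \notin S -> z \notin S ->
  upper_bd s S -> upper_bd (insert oct_map s (x, y, z)) (n :: S).
Proof.
move=> Sn yS zS [uS iS dS]; split.
- by rewrite /= uS andbT; apply/negP => /(allP Sn); rewrite ltnn.
- have old v u : (n <= v)%N -> adjE (eds s) v u = false.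
    by move=> nv; apply/negP => /s_lt/andP[]; lia.
  have nS j : j \in S -> ~~ adjE (eds (insert oct_map s (x, y, z))) n j.
    move=> Sj; rewrite adjE_oct old // orbF.
    have jy : j != y by apply: contraNneq yS => <-.
    have jz : j != z by apply: contraNneq zS => <-.
    by have := allP Sn _ Sj => jn; apply: (oct_eds0 xs ys zs) => //; lia.
  move=> i j; rewrite /= !inE => /predU1P[->|Si] /predU1P[->|Sj].
  + by rewrite adjE_oct old // orbF; apply: (oct_eds0 xs ys zs); lia.
  + exact: nS.
  + by rewrite adjE_sym; exact: nS.
  + have := iS _ _ Si Sj; rewrite adjE_oct negb_or => ->; rewrite andbT.
    exact: (oct_eds_lt xs ys zs (allP Sn _ Si) (allP Sn _ Sj)).
- move=> v /= vn; have [/dS[Sv|[u Su vu]]|nv] := ltnP v n.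
  + by left; rewrite /= inE; apply/orP; right.
  + right; exists u; last by rewrite adjE_oct vu orbT.
    by rewrite /= inE; apply/orP; right.
  have [vE|vE] := eqVneq v n; first by left; rewrite /= inE vE eqxx.
  right; exists n; first by rewrite /= inE eqxx.
  rewrite adjE_oct /adjE /oct_eds !inE !xpair_eqE.
  by have [->|->] : v = n.+1 \/ v = n.+2 by [lia|]; rewrite !eqxx ?orbT.
Qed.

End Bounds.

(** * The strip of stacked vertices, filled with octahedra *)

(** One stacking and two octahedra add seven vertices. Where vertex 1 is a corner it is listed
    first: it then dominates the stacked vertex, and the first new vertex of an octahedron is the
    one not adjacent to it. *)
Definition strip_step (sf : cmap * nat) : cmap * nat :=
  let: (s, f) := sf in
  let s1 := insert stack_map s (1, 2, f)%N in
  let s2 := insert oct_map s1 (1%N, f, nv s) in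
  (insert oct_map s2 (2%N, f, nv s), nv s).

(* The second component is the last stacked vertex: it forms with 1 and 2 the
   only face into which the strip is continued. *)
Definition strip k : cmap * nat := iter k strip_step (stack_map, 3%N).

(** The last open face is filled; the faces at vertex 0, one of which is the exterior, stay
    empty. *)
Definition strip_closed k : cmap :=
  insert oct_map (strip k).1 (1%N, 2%N, (strip k).2).

(** The value [2 * k + 1] counts the [2 * k] octahedra and one element in the closed neighbourhood
    of vertex 0. The corners of the next face to be filled are kept exempt in [si_lower]. *)
Record strip_inv (R : realType) k (s : cmap) (f : nat) : Prop := StripInv {
  si_drawn : exists pos : nat -> R * R, drawn s pos;
  si_nv : nv s = (7 * k + 4)%N;
  si_f : (2 < f < nv s)%N;
  si_face : (1, 2, f)%N \in fcs s;
  si_lower : exists W, [/\ {subset [:: 1; 2; f]%N <= W},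
    forall w, w \in W -> (w < nv s)%N & lower_bd s W (2 * k + 1)];
  si_upper : exists S, [/\ size S = (2 * k + 1)%N, all (fun v => (v < nv s)%N) S,
    1%N \in S & upper_bd s S] }.

Lemma drawn_edges_lt (R : realType) s (pos : nat -> R * R) : drawn s pos -> edges_lt s.
Proof. by move=> ds i j /orP[] /(dw_edge ds)[/= -> ->]. Qed.

Lemma strip_inv0 (R : realType) : strip_inv R 0 stack_map 3.
Proof.
split=> //; first by exists (@stack_pos R); exact: stack_drawn.
(* Only vertex 0 has to be dominated, which forces one element into its closed neighbourhood. *)
- exists [:: 1; 2; 3]%N; split=> // [w|S iS dS].
    by rewrite !inE => /or3P[] /eqP->.
  rewrite -has_count; apply/hasP.
  have [//|//|S0|[u Su]] := dS 0%N; first by exists 0%N.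
  move=> vu; exists u => //; rewrite mem_iota.
  by move: vu; rewrite /adjE !inE !xpair_eqE /= ?andbF ?orbF; lia.
- exists [:: 1%N]; split=> //; split=> // [i j|v].
    by rewrite /= !inE => /eqP-> /eqP->.
  move=> vn; case: v vn => [|[|[|[|//]]]] _; [right|left|right|right] => //;
  by exists 1%N.
Qed.

Lemma strip_invS (R : realType) k s f : strip_inv R k s f ->
  strip_inv R k.+1 (strip_step (s, f)).1 (strip_step (s, f)).2.
Proof.
case=> -[pos ds] nvE /andP[f2 fs] face [W [sW Wlt lb]] [S [sizeS Slt S1 ub]] /=.
have ds1 := insert_drawn (stack_drawn R) ds face; move: ds1.
move E1: (insert stack_map s _) => s1 ds1.
have nv1 : nv s1 = (nv s).+1 by rewrite -E1 /= addn1.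
have face1 : (1%N, f, nv s) \in fcs s1.
  by rewrite -E1 /= /loc3 /= addn0 !inE eqxx orbT.
have ds2 := insert_drawn (oct_drawn R) ds1 face1; move: ds2.
move E2: (insert oct_map s1 _) => s2 ds2.
have nv2 : nv s2 = (nv s + 4)%N by rewrite -E2 /= nv1 addSnnS.
have face2 : (2%N, f, nv s) \in fcs s2.
  rewrite -E2 mem_cat mem_filter; apply/orP; right; apply/andP; split=> //.
  by rewrite -E1 /= /loc3 /= addn0 !inE eqxx !orbT.
have ds3 := insert_drawn (oct_drawn R) ds2 face2; move: ds3.
move E3: (insert oct_map s2 _) => s3 ds3.
have nv3 : nv s3 = (nv s + 7)%N by rewrite -E3 /= nv2 -addnA.
have face3 : (1%N, 2%N, nv s) \in fcs s3.
  rewrite -E3 mem_cat mem_filter; apply/orP; right; apply/andP; split=> //.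
  rewrite -E2 mem_cat mem_filter; apply/orP; right; apply/andP; split=> //.
    by rewrite !xpair_eqE; clear -f2; lia.
  by rewrite -E1 /= /loc3 /= addn0 !inE eqxx.
have lt := drawn_edges_lt ds; have lt1 := drawn_edges_lt ds1; have lt2 := drawn_edges_lt ds2.
have [a12 a2f af1] := dw_fadj ds face.
have [/= b1 b2 b3] := dw_fadj ds1 face1; have [/= c1 c2 c3] := dw_fadj ds2 face2.
have [W1 W2 Wf] : [/\ 1%N \in W, 2%N \in W & f \in W].
  by split; apply: sW; rewrite !inE eqxx ?orbT.
(* The octahedra need corners outside [S]: [f] is adjacent to 1, which is in [S], and [nv s] is
   new. *)
have f0 : f \notin S.
  apply/negP => Sf; case: ub => _ iS _; have := iS _ _ Sf S1; by rewrite af1.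
have n0 : nv s \notin S by apply/negP => /(allP Slt); rewrite ltnn.
split.
- by eexists; exact: ds3.
- by rewrite nv3 nvE; clear; lia.
- by rewrite nv3; clear -f2 fs; lia.
- exact: face3.
(* The stacked vertex becomes exempt, and each of the two octahedra raises the bound by one. *)
- exists (nv s :: W); split.
  + by move=> w; rewrite !inE => /or3P[] /eqP->; rewrite ?W1 ?W2 ?eqxx ?orbT.
  + by move=> w; rewrite inE => /predU1P[->|/Wlt]; rewrite nv3; clear; lia.
  rewrite (_ : (2 * k.+1 + 1)%N = (2 * k + 1).+2); last by clear; lia.
  rewrite -E3; apply: oct_lower => //; rewrite ?nv2; try (clear -f2 fs; lia).
  + by move=> w; rewrite !inE => /or3P[] /eqP->; rewrite ?W2 ?Wf ?eqxx ?orbT.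
  + by move=> w; rewrite inE => /predU1P[->|/Wlt]; clear; lia.
  rewrite -E2; apply: oct_lower => //; rewrite ?nv1; try (clear -f2 fs; lia).
  + by move=> w; rewrite !inE => /or3P[] /eqP->; rewrite ?W1 ?Wf ?eqxx ?orbT.
  + by move=> w; rewrite inE => /predU1P[->|/Wlt]; clear; lia.
  by rewrite -E1; apply: stack_lower => //; clear -f2 fs; lia.
(* [nv s1] and [nv s2] are the first new vertices of the two octahedra. *)
- exists [:: nv s2, nv s1 & S]; split.
  + by rewrite /= sizeS; clear; lia.
  + rewrite /= nv3 nv2 nv1; apply/and3P; split; [clear; lia|clear; lia|].
    by apply: sub_all Slt => v /=; clear; lia.
  + by rewrite !inE S1 !orbT.
  have ub1 : upper_bd s1 S by rewrite -E1; apply: stack_upper => //; clear -f2 fs; lia.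
  have ub2 : upper_bd s2 (nv s1 :: S).
    rewrite -E2; apply: oct_upper => //; rewrite ?nv1; try (clear -f2 fs; lia).
    by apply: sub_all Slt => v /=; clear; lia.
  rewrite -E3; apply: oct_upper => //; rewrite ?nv2 ?nv1; try (clear -f2 fs; lia).
  + by rewrite /=; apply/andP; split; [clear; lia|apply: sub_all Slt => v /=; clear; lia].
  + by rewrite inE negb_or f0 andbT; clear -fs; lia.
  + by rewrite inE negb_or n0 andbT; clear; lia.
Qed.

Lemma stripP (R : realType) k : strip_inv R k (strip k).1 (strip k).2.
Proof.
elim: k => [|k IH]; first exact: strip_inv0.
by have := strip_invS IH; rewrite /strip iterS -surjective_pairing.
Qed.

Lemma strip_closedP (R : realType) k : let s := strip_closed k in
  [/\ exists pos : nat -> R * R, drawn s pos, nv s = (7 * k.+1)%N,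
      exists W, lower_bd s W (2 * k.+1) &
      exists S, size S = (2 * k.+1)%N /\ upper_bd s S].
Proof.
rewrite /strip_closed /=; case: (stripP R k) => -[pos ds] nvE.
move: (strip k).1 (strip k).2 ds nvE => s f ds nvE /andP[f2 fs] face.
move=> [W [sW Wlt lb]] [S [sizeS Slt S1 ub]].
have [a12 a2f af1] := dw_fadj ds face; have lt := drawn_edges_lt ds.
split.
- by eexists; exact: (insert_drawn (oct_drawn R) ds face).
- by rewrite /= nvE; clear; lia.
- exists W; rewrite (_ : (2 * k.+1)%N = (2 * k + 1).+1); last by clear; lia.
  by apply: oct_lower => //; clear -f2 fs; lia.
- exists (nv s :: S); split; first by rewrite /= sizeS; clear; lia.
  case: (ub) => _ iS _; apply: oct_upper => //; try (clear -f2 fs; lia).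
  + by apply/negP => S2; have := iS _ _ S1 S2; rewrite a12.
  + by apply/negP => Sf; have := iS _ _ Sf S1; rewrite af1.
Qed.

(** * Transfer of the bounds to the independent domination number *)

Section IndepDomNumber.
Variables (R : realType) (s : cmap) (pos : nat -> R * R).
Hypothesis ds : drawn s pos.

Lemma cadjE (i j : cgraph s) : adj i j = adjE (eds s) i j.
Proof.
rewrite /= /cadj; have [->|//] := eqVneq i j.
by apply/esym/negP => /(adjE_neq ds); rewrite eqxx.
Qed.

Lemma lower_bd_card W c (S : {set cgraph s}) : lower_bd s W c ->
  independent S -> dominating S -> (c <= #|S|)%N.
Proof.
move=> lb iS dS; pose T := [pred v | v \in [seq val i | i <- enum S]].
have memT (i : cgraph s) : T (val i) = (i \in S).
  by rewrite /= mem_map ?mem_enum //; exact: val_inj.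
have -> : #|S| = count T (iota 0 (nv s)).
  rewrite -val_enum_ord count_map enumT cardE /enum_mem size_filter.
  by apply: eq_count => i; exact: esym (memT i).
apply: lb => [_ _ /mapP[i iS' ->] /mapP[j jS' ->]|v vn _].
  rewrite !mem_enum in iS' jS'; rewrite -cadjE.
  by move/forall_inP: iS => /(_ _ iS') /forall_inP; apply.
have /orP[vS|/exists_inP[u uS vu]] := forallP dS (Ordinal vn).
  by left; rewrite -[v]/(val (Ordinal vn)) memT.
right; exists (val u); first by rewrite memT.
by have := vu; rewrite cadjE.
Qed.

Lemma upper_bd_set S : upper_bd s S -> exists A : {set cgraph s},
  [/\ independent A, dominating A & (#|A| <= size S)%N].
Proof.
move=> [uS iS dS]; exists [set i | val i \in S]%SET; split.
- apply/forall_inP => i; rewrite finset.inE => Si.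
  by apply/forall_inP => j; rewrite finset.inE => Sj; rewrite cadjE; exact: iS.
- apply/forallP => v; have [Sv|[u Su vu]] := dS _ (ltn_ord v).
    by rewrite finset.inE; apply/orP; left.
  have un : (u < nv s)%N by have /andP[] := drawn_edges_lt ds vu.
  apply/orP; right; apply/exists_inP; exists (Ordinal un).
    by rewrite finset.inE.
  by rewrite cadjE.
- rewrite cardE -(size_map val); apply: uniq_leq_size.
    by rewrite map_inj_uniq ?enum_uniq //; exact: val_inj.
  by move=> _ /mapP[i + ->]; rewrite mem_enum finset.inE.
Qed.

Lemma indep_dom_numberE W S : lower_bd s W (size S) -> upper_bd s S ->
  indep_dom_number (cgraph s) = size S.
Proof.
move=> lb /upper_bd_set[A [iA dA cA]]; apply/eqP; rewrite eqn_leq; apply/andP; split.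
  apply: leq_trans cA; rewrite /indep_dom_number.
  have : A \in index_enum _ by exact: mem_index_enum.
  elim: (index_enum _) => // B r IH; rewrite inE big_cons => /predU1P[<-|/IH{}IH].
    by rewrite iA dA /= geq_minl.
  by case: ifP => // _; apply: leq_trans IH; exact: geq_minr.
apply: (big_ind (fun m => (size S <= m)%N)).
(* The default value of the minimum is at least [#|A|], so it obeys the bound as well. *)
- apply: leq_trans (max_card (mem A)); exact: lower_bd_card lb iA dA.
- by move=> a b; rewrite leq_min => -> ->.
- by move=> B /andP[iB dB]; exact: lower_bd_card lb iB dB.
Qed.

End IndepDomNumber.

Theorem theorem9 (R : realType) :
  exists F : plane_graph R -> Prop,
    infinite_family F /\
    forall G : plane_graph R, F G ->
      planar_triangulation G /\
      (indep_dom_number G)%:R = 2 * (#|G|)%:R / 7 :> rat.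
Proof.
have /choice[G GP] : forall k, exists G : plane_graph R,
    [/\ planar_triangulation G, #|G| = (7 * k.+1)%N &
        indep_dom_number G = (2 * k.+1)%N].
  move=> k.
  have [[pos ds] nvE [W lb] [S [sizeS ub]]] := strip_closedP R k.
  exists (cplane ds); split; first exact: cplane_triangulation.
    by rewrite /= card_ord.
  by rewrite -sizeS; apply: (indep_dom_numberE ds _ ub); rewrite sizeS; exact: lb.
exists (fun H => exists k, H = G k); split.
  exists G; split=> [k|i j [f [bf _]]]; first by exists k.
  (* Isomorphic members have equally many vertices, and [7 * k.+1] determines [k]. *)
  have := bij_eq_card bf; have [_ -> _] := GP i; have [_ -> _] := GP j.
  lia.
move=> _ [k ->]; have [tri -> ->] := GP k; split=> //.
by rewrite !natrM; field.
Qed.
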